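(* Let $\mathcal{O}\subset \mathbb{P}^n$ be an open subset. Then there is no complex Riemannian foliation $\mathcal{F}$ of $\mathcal{O}$ with $\operatorname{codim}_{\mathbb{C}}(\mathcal{F}) = 1$.
   Context: $\mathbb{P}^n$ denotes complex projective space of complex dimension $n$ equipped with the standard Fubini-Study metric of holomorphic sectional curvature $4$ and its complex structure $J$; an open subset $\mathcal{O}$ carries the induced metric and complex structure. A foliation $\mathcal{F}$ of a smooth manifold $\overline{M}$ is a decomposition of $\overline{M}$ into injectively immersed submanifolds, called leaves, such that $T_pL=\{X_p : X\in \Xi_{\mathcal{F}}\}$ for every leaf $L$ and every $p\in L$, where $\Xi_{\mathcal{F}}$ is the space of smooth vector fields that are everywhere tangent to the leaves. The leaves need not all have the same dimension (the foliation is called regular if they do, and singular otherwise). If $\overline{M}$ is Riemannian, $\mathcal{F}$ is called Riemannian if a geodesic is orthogonal to all or none of the leaves that it meets. The real dimension $\dim_{\mathbb{R}}(\mathcal{F})$ is the real dimension of a leaf of maximal dimension. A submanifold $X$ is complex if $J T_pX\subset T_pX$ for all $p\in X$. A foliation is complex if every leaf is a complex submanifold; its complex dimension is $\dim_{\mathbb{C}}(\mathcal{F})=\dim_{\mathbb{R}}(\mathcal{F})/2$, and its complex codimension is $\operatorname{codim}_{\mathbb{C}}(\mathcal{F})=n-\dim_{\mathbb{C}}(\mathcal{F})$.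
   Formalization: The formal theorem assumes n ≥ 2: for n = 1 the decomposition of any nonempty open subset of the projective line into points is a complex Riemannian foliation of complex codimension 1, so the claim fails there. *)

(* Defs.v *)
From HB Require Import structures.
From mathcomp Require Import all_boot all_order all_algebra.
From mathcomp Require Import all_classical all_reals all_analysis.
From mathcomp Require Import ring lra.

Set Implicit Arguments.
Unset Strict Implicit.
Unset Printing Implicit Defensive.

Import Order.TTheory GRing.Theory Num.Theory.
Import numFieldNormedType.Exports.
Local Open Scope classical_set_scope.
Local Open Scope ring_scope.

(* Meaningful for U open; since V is finite dimensional in all uses below,
   continuity of all directional derivatives amounts to continuity of the
   differential. *)
Fixpoint Ck (R : realType) (V W : normedModType R) (k : nat) (U : set V)
    (f : V -> W) : Prop :=
  match k with
  | 0 => forall x, U x -> {for x, continuous f}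
  | k'.+1 => (forall x, U x -> differentiable f x) /\
             (forall v : V, Ck k' U (fun x => 'D_v f x))
  end.

Definition smooth (R : realType) (V W : normedModType R) (U : set V)
    (f : V -> W) : Prop := forall k, Ck k U f.

(* Smoothness on an arbitrary subset: local smooth extendability. *)
Definition smooth_on_subset (R : realType) (V W : normedModType R) (O : set V)
    (f : V -> W) : Prop :=
  forall p, O p -> exists (U : set V) (g : V -> W),
    [/\ open U, U p, smooth U g & {in U `&` O, g =1 f}].

(* An injectively immersed submanifold of W, given by a countable atlas
   (chart domains may be empty) of injective smooth immersions of open subsets
   of R^sdim.  The last axiom says that the charts define on their common
   image a topology and a smooth structure, possibly finer than the topology
   induced by W, for which the inclusion is an immersion. *)
Record submanifold (R : realType) (W : normedModType R) := Submanifold {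
  sdim : nat;
  chart_dom : nat -> set 'rV[R]_sdim;
  chart : nat -> 'rV[R]_sdim -> W;
  chart_open : forall i, open (chart_dom i);
  chart_smooth : forall i, smooth (chart_dom i) (chart i);
  chart_inj : forall i, {in chart_dom i &, injective (chart i)};
  chart_immersion : forall i u, chart_dom i u ->
    forall w, 'D_w (chart i) u = 0 -> w = 0;
  chart_compat : forall i j,
    let D := chart_dom i `&` chart i @^-1` (chart j @` chart_dom j) in
    open D /\
    exists2 tau : 'rV[R]_sdim -> 'rV[R]_sdim, smooth D tau &
      forall u, D u -> chart_dom j (tau u) /\ chart j (tau u) = chart i u
}.

Arguments chart_dom {R W} _ _ _.
Arguments chart {R W} _ _ _.

Definition points (R : realType) (W : normedModType R) (L : submanifold W) :
    set W :=
  [set p | exists i u, chart_dom L i u /\ chart L i u = p].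

Definition tangent (R : realType) (W : normedModType R) (L : submanifold W)
    (p : W) : set W :=
  [set X | exists i u, [/\ chart_dom L i u, chart L i u = p &
                          exists w, 'D_w (chart L i) u = X]].

Definition tangent_field (R : realType) (W : normedModType R) (O : set W)
    (A : Type) (leaf : A -> submanifold W) (X : W -> W) : Prop :=
  smooth_on_subset O X /\
  forall a p, points (leaf a) p -> tangent (leaf a) p (X p).

Record foliation (R : realType) (W : normedModType R) (O : set W) :=
  Foliation {
  leaf_idx : Type;
  leaf : leaf_idx -> submanifold W;
  leaf_nonempty : forall a, points (leaf a) !=set0;
  leaf_cover : \bigcup_a points (leaf a) = O;
  leaf_disjoint : forall a b p,
    points (leaf a) p -> points (leaf b) p -> a = b;
  leaf_tangent : forall a p, points (leaf a) p ->
    tangent (leaf a) p = [set X p | X in tangent_field O leaf]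
}.

Arguments leaf {R W O} _ _.

Definition real_dim (R : realType) (W : normedModType R) (O : set W)
    (F : foliation O) (d : nat) : Prop :=
  (exists a, sdim (leaf F a) = d) /\ (forall a, (sdim (leaf F a) <= d)%N).

Definition complex_dim (R : realType) (W : normedModType R) (O : set W)
    (F : foliation O) (m : nat) : Prop := real_dim F (2 * m).

(* n is the complex dimension of the ambient manifold. *)
Definition complex_codim (R : realType) (W : normedModType R) (O : set W)
    (n : nat) (F : foliation O) (c : nat) : Prop :=
  exists2 m, complex_dim F m & n = (m + c)%N.

(* C^{n+1} is the space of columns (x; y) = x + i y over R, on which
   multiplication by i is the matrix [imx].  A complex line in C^{n+1}, i.e. a
   real plane stable under [imx], is represented by the orthogonal projector
   onto it, so P^n is a closed embedded submanifold of the Euclidean space of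
   real square matrices of size 2n+2. *)

Notation ambient R n := ('M[R]_(n.+1 + n.+1)).

Definition imx (R : realType) (n : nat) : ambient R n :=
  block_mx 0 (- 1%:M) 1%:M 0.

Definition CP (R : realType) (n : nat) : set (ambient R n) :=
  [set P | [/\ P^T = P, P *m P = P, P *m imx R n = imx R n *m P & \tr P = 2]].
Arguments CP : clear implicits.

(* Linearization at P of the equations defining [CP]. *)
Definition tangentCP (R : realType) (n : nat) (P : ambient R n) :
    set (ambient R n) :=
  [set X | [/\ X^T = X, X *m P + P *m X = X & X *m imx R n = imx R n *m X]].

(* The complex structure of T_P P^n, see [JCP_dhopf]. *)
Definition JCP (R : realType) (n : nat) (P X : ambient R n) : ambient R n :=
  imx R n *m (X *m P - P *m X).

(* The Fubini-Study metric is induced by this Euclidean scalar product; the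
   factor is the one that makes the Hopf map from the unit sphere a Riemannian
   submersion, see [fubini_study_dhopf], so that the holomorphic sectional
   curvature is 4. *)
Definition fubini_study (R : realType) (n : nat) (X Y : ambient R n) : R :=
  \tr (X^T *m Y) / 4.

Definition open_in_CP (R : realType) (n : nat) (O : set (ambient R n)) : Prop :=
  exists2 U : set (ambient R n), open U & O = CP R n `&` U.

(* The Levi-Civita connection of a submanifold of a Euclidean space is the
   tangential part of the ambient derivative: the geodesics are the curves
   whose acceleration is normal. *)
Definition geodesic (R : realType) (n : nat) (I : set R)
    (c : R -> ambient R n) : Prop :=
  [/\ smooth I c, (forall t, I t -> CP R n (c t)) &
      forall t, I t -> forall X, tangentCP (c t) X ->
        fubini_study ('D_1 ('D_1 c) t) X = 0].

Definition orthogonal_at (R : realType) (n : nat) (O : set (ambient R n))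
    (F : foliation O) (c : R -> ambient R n) (t : R) : Prop :=
  forall a, points (leaf F a) (c t) ->
  forall X, tangent (leaf F a) (c t) X -> fubini_study ('D_1 c t) X = 0.

Definition riemannian (R : realType) (n : nat) (O : set (ambient R n))
    (F : foliation O) : Prop :=
  forall (I : set R) (c : R -> ambient R n),
    open I -> is_interval I -> geodesic I c -> (forall t, I t -> O (c t)) ->
    (forall t, I t -> orthogonal_at F c t) \/
    (forall t, I t -> ~ orthogonal_at F c t).

Definition complex_submanifold (R : realType) (n : nat)
    (L : submanifold (ambient R n)) : Prop :=
  forall P, points L P -> forall X, tangent L P X -> tangent L P (JCP P X).

Definition complex_foliation (R : realType) (n : nat) (O : set (ambient R n))
    (F : foliation O) : Prop :=
  forall a, complex_submanifold (leaf F a).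

(* The Hopf map from the unit sphere of C^{n+1} identifies the above with the
   usual description of P^n as the quotient of the sphere by the unit circle. *)

Section Hopf.
Variables (R : realType) (n : nat).
Local Notation C := ('cV[R]_(n.+1 + n.+1)).
Local Notation J := (imx R n).

Definition dot (v w : C) : R := \tr (v^T *m w).

Definition hopf (z : C) : ambient R n :=
  z *m z^T + (J *m z) *m (J *m z)^T.

Definition dhopf (z v : C) : ambient R n :=
  v *m z^T + z *m v^T + (J *m v) *m (J *m z)^T + (J *m z) *m (J *m v)^T.

(* The orthogonal complement of the complex line spanned by z. *)
Definition horizontal (z : C) : set C :=
  [set v | dot z v = 0 /\ dot (J *m z) v = 0].

Lemma tr_imx : J^T = - J.
Proof.
by rewrite /imx tr_block_mx opp_block_mx !trmx0 !oppr0 linearN /= trmx1 opprK.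
Qed.

Lemma imxK (m : nat) (A : 'M[R]_(_, m)) : J *m (J *m A) = - A.
Proof.
rewrite mulmxA /imx mulmx_block !mul0mx !mulmx0 mulmx1 mulmxN mulmx1.
rewrite !addr0 !add0r; set B := block_mx _ _ _ _.
suff -> : B = - 1%:M by rewrite mulNmx mul1mx.
by rewrite /B scalar_mx_block opp_block_mx !oppr0.
Qed.

(* [dhopf z v] is the differential of [hopf] at z in the direction v. *)
Lemma hopf_expand (z v : C) (t : R) :
  hopf (z + t *: v) = hopf z + t *: dhopf z v + t ^+ 2 *: hopf v.
Proof.
rewrite /hopf /dhopf mulmxDr -scalemxAr.
have E (a b : C) : (a + t *: b) *m (a + t *: b)^T =
    a *m a^T + t *: (b *m a^T + a *m b^T) + t ^+ 2 *: (b *m b^T).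
  rewrite linearD linearZ /= mulmxDl !mulmxDr -!scalemxAl -!scalemxAr scalerA.
  by rewrite -expr2 scalerDr !addrA; congr (_ + _); exact: addrAC.
by rewrite !E !scalerDr; apply/matrixP => i j; rewrite !mxE; ring.
Qed.

Lemma dotC (v w : C) : dot v w = dot w v.
Proof. by rewrite /dot -[LHS]mxtrace_tr trmx_mul trmxK. Qed.

Lemma dot_scalar (v w : C) : v^T *m w = (dot v w)%:M.
Proof. by rewrite [LHS]mx11_scalar /dot /mxtrace big_ord1. Qed.

Lemma dot_imx (v w : C) : dot (J *m v) w = - dot v (J *m w).
Proof. by rewrite /dot trmx_mul tr_imx mulmxN mulNmx raddfN /= mulmxA. Qed.

Lemma dot_imxx (v : C) : dot (J *m v) v = 0.
Proof.
have := dot_imx v v; rewrite [dot v (J *m v)]dotC.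
by move: (dot _ _) => x; lra.
Qed.

Lemma dotZl a (v w : C) : dot (a *: v) w = a * dot v w.
Proof. by rewrite /dot [(a *: v)^T]linearZ /= -scalemxAl mxtraceZ. Qed.

Lemma dotDl (u v w : C) : dot (u + v) w = dot u w + dot v w.
Proof. by rewrite /dot [(u + v)^T]linearD /= mulmxDl mxtraceD. Qed.

Lemma dot_ge0 (v : C) : 0 <= dot v v.
Proof.
rewrite /dot /mxtrace big_ord1 mxE; apply: sumr_ge0 => i _.
by rewrite mxE -expr2 sqr_ge0.
Qed.

Lemma dot_eq0 (v : C) : dot v v = 0 -> v = 0.
Proof.
rewrite /dot /mxtrace big_ord1 mxE => /eqP.
rewrite psumr_eq0 => [/allP v0|i _]; last by rewrite mxE -expr2 sqr_ge0.
apply/colP => i; have := v0 i; rewrite mem_index_enum => /(_ isT) /=.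
by rewrite !mxE -expr2 sqrf_eq0 => /eqP.
Qed.

Lemma col_eq0 (A : ambient R n) : (forall j, col j A = 0) -> A = 0.
Proof.
by move=> A0; apply/matrixP => i j; have /colP/(_ i) := A0 j; rewrite !mxE.
Qed.

Lemma hopf_mul (z v : C) :
  hopf z *m v = dot z v *: z + dot (J *m z) v *: (J *m z).
Proof. by rewrite /hopf mulmxDl -!(mulmxA _ _^T) !dot_scalar !mul_mx_scalar. Qed.

Lemma hopf_tr (z : C) : (hopf z)^T = hopf z.
Proof. by rewrite /hopf linearD /= !trmx_mul !trmxK. Qed.

Lemma hopf_imx (z : C) : hopf z *m J = J *m hopf z.
Proof.
have E (a : C) : a^T *m J = - (J *m a)^T.
  by rewrite trmx_mul tr_imx mulmxN opprK.
rewrite /hopf mulmxDl mulmxDr -!(mulmxA _ _^T J) !E imxK [(- z)^T]linearN /=.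
by rewrite !mulmxN opprK !(mulmxA J) -(mulmxA J J) imxK mulNmx addrC.
Qed.

Lemma hopf_CP (z : C) : dot z z = 1 -> CP R n (hopf z).
Proof.
move=> z1; have Jz1 : dot (J *m z) (J *m z) = 1.
  by rewrite dot_imx imxK /dot mulmxN raddfN /= opprK.
have zJ : dot z (J *m z) = 0 by rewrite dotC dot_imxx.
have hz : hopf z *m z = z by rewrite hopf_mul z1 dot_imxx scale1r scale0r addr0.
have hJz : hopf z *m (J *m z) = J *m z.
  by rewrite hopf_mul Jz1 zJ scale1r scale0r add0r.
split; [exact: hopf_tr| |exact: hopf_imx|].
  by rewrite {2}/hopf mulmxDr !mulmxA hz -(mulmxA _ J) hJz.
by rewrite /hopf raddfD /= !(mxtrace_mulC _ _^T) -/(dot _ _) -/(dot _ _) z1 Jz1.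
Qed.

Lemma CPE : CP R n = hopf @` [set z | dot z z = 1].
Proof.
apply/seteqP; split=> [P [PT PP PJ trP]|_ [z z1 <-]]; last exact: hopf_CP.
have [u Pu0] : exists u : C, P *m u != 0.
  apply: contrapT => P0; have PE : P = 0.
    apply: col_eq0 => j; rewrite colE; apply/eqP.
    by apply: contra_notT P0 => Pj; exists (delta_mx j 0).
  by move: trP; rewrite PE mxtrace0; lra.
have nu : 0 < dot (P *m u) (P *m u).
  rewrite lt_def dot_ge0 andbT; apply: contra_neq Pu0; exact: dot_eq0.
set s := Num.sqrt (dot (P *m u) (P *m u)).
have s0 : s != 0 by rewrite sqrtr_eq0 -ltNge.
pose z := s^-1 *: (P *m u).
have z1 : dot z z = 1.
  rewrite /z dotZl dotC dotZl -[dot _ _]sqr_sqrtr ?ltW// -/s.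
  by field.
have Pz : P *m z = z by rewrite /z -scalemxAr mulmxA PP.
have PJz : P *m (J *m z) = J *m z by rewrite mulmxA PJ -mulmxA Pz.
exists z => //; have [QT QQ _ trQ] := hopf_CP z1.
have PQ : P *m hopf z = hopf z by rewrite /hopf mulmxDr !mulmxA Pz -(mulmxA P) PJz.
have QP : hopf z *m P = hopf z by apply: trmx_inj; rewrite trmx_mul PT QT.
pose D := P - hopf z.
have : \tr (D^T *m D) = 0.
  have -> : D^T = D by rewrite /D [LHS]linearB /= PT QT.
  rewrite /D mulmxBl !mulmxBr PP PQ QP QQ subrr subr0.
  by rewrite raddfB /= trP trQ subrr.
have DE : \tr (D^T *m D) = \sum_j dot (col j D) (col j D).
  apply: eq_bigr => j _; rewrite /dot /mxtrace big_ord1 !mxE.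
  by apply: eq_bigr => k _; rewrite !mxE.
move=> /eqP; rewrite DE psumr_eq0 => [/allP D0|? _]; last exact: dot_ge0.
suff : D = 0 by move=> /eqP; rewrite subr_eq0 => /eqP.
apply: col_eq0 => j; apply: dot_eq0; apply/eqP.
by apply: D0; rewrite mem_index_enum.
Qed.

(* The fibres of [hopf] on the sphere are the circles of unit multiples. *)
Lemma hopf_eq (z w : C) : dot z z = 1 -> dot w w = 1 ->
  hopf z = hopf w <->
  exists a b : R, a ^+ 2 + b ^+ 2 = 1 /\ w = a *: z + b *: (J *m z).
Proof.
move=> z1 w1; have Jz1 : dot (J *m z) (J *m z) = 1.
  by rewrite dot_imx imxK /dot mulmxN raddfN /= opprK.
have zJ : dot z (J *m z) = 0 by rewrite dotC dot_imxx.
split=> [zw|[a [b [ab ->]]]].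
  have ww : hopf w *m w = w by rewrite hopf_mul w1 dot_imxx scale1r scale0r addr0.
  have wE : w = dot z w *: z + dot (J *m z) w *: (J *m z).
    by rewrite -hopf_mul zw ww.
  exists (dot z w), (dot (J *m z) w); split=> //.
  by have := congr1 (dot^~ w) wE; rewrite w1 dotDl !dotZl -!expr2.
have Jw : J *m (a *: z + b *: (J *m z)) = a *: (J *m z) - b *: z.
  by rewrite mulmxDr -!scalemxAr imxK scalerN.
have E (u v : C) c d : (c *: u + d *: v) *m (c *: u + d *: v)^T =
    c ^+ 2 *: (u *m u^T) + (c * d) *: (u *m v^T + v *m u^T) +
    d ^+ 2 *: (v *m v^T).
  rewrite linearD !linearZ /= mulmxDl !mulmxDr -!scalemxAl -!scalemxAr !scalerA.
  by rewrite -!expr2 scalerDr !addrA [d * c]mulrC.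
rewrite /hopf Jw -scaleNr !E; apply/matrixP => i j.
by rewrite !mxE -[LHS]mul1r -ab; ring.
Qed.

Let half (z v : C) : ambient R n := v *m z^T + (J *m v) *m (J *m z)^T.

Let dhopf_half z v : dhopf z v = half z v + (half z v)^T.
Proof.
rewrite /dhopf /half [(_ + _)^T]linearD /= !trmx_mul !trmxK -!addrA.
by congr (_ + _); rewrite addrCA.
Qed.

Let half_imx z v : half z v *m J = J *m half z v.
Proof.
have E (a : C) : a^T *m J = - (J *m a)^T.
  by rewrite trmx_mul tr_imx mulmxN opprK.
rewrite /half mulmxDl mulmxDr -!(mulmxA _ _^T J) !E imxK [(- z)^T]linearN /=.
by rewrite !mulmxN opprK !(mulmxA J) -(mulmxA J J) imxK mulNmx addrC.
Qed.

Let half_tr_imx z v : (half z v)^T *m J = J *m (half z v)^T.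
Proof.
apply: trmx_inj; rewrite !trmx_mul !trmxK tr_imx mulNmx mulmxN.
by rewrite half_imx.
Qed.

Let hopf_fix z : dot z z = 1 -> hopf z *m z = z.
Proof. by move=> z1; rewrite hopf_mul z1 dot_imxx scale1r scale0r addr0. Qed.

Let hopf_fixJ z : dot z z = 1 -> hopf z *m (J *m z) = J *m z.
Proof. by move=> z1; rewrite mulmxA hopf_imx -mulmxA hopf_fix. Qed.

Let hopf_half z v : horizontal z v -> hopf z *m half z v = 0.
Proof.
move=> [v0 v1]; have hv : hopf z *m v = 0.
  by rewrite hopf_mul v0 v1 !scale0r addr0.
rewrite /half mulmxDr mulmxA hv mul0mx add0r mulmxA (mulmxA _ J) hopf_imx.
by rewrite -(mulmxA J) hv mulmx0 mul0mx.
Qed.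

Let half_hopf z v : dot z z = 1 -> half z v *m hopf z = half z v.
Proof.
move=> z1; apply: trmx_inj; rewrite trmx_mul hopf_tr /half [(_ + _)^T]linearD /=.
by rewrite !trmx_mul !trmxK mulmxDr !(mulmxA (hopf z)) -(mulmxA _ J) hopf_fix //
  hopf_fixJ.
Qed.

Let half_tr_hopf z v : horizontal z v -> (half z v)^T *m hopf z = 0.
Proof. by move=> hv; rewrite -[hopf z]hopf_tr -trmx_mul hopf_half ?trmx0. Qed.

Let hopf_half_tr z v : dot z z = 1 -> hopf z *m (half z v)^T = (half z v)^T.
Proof. by move=> z1; rewrite -[hopf z]hopf_tr -trmx_mul half_hopf. Qed.

(* For unit z, [dhopf z] maps the horizontal space onto the tangent space,
   isometrically and complex linearly. *)
Lemma tangentCPE (z : C) : dot z z = 1 ->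
  tangentCP (hopf z) = dhopf z @` horizontal z.
Proof.
move=> z1; apply/seteqP; split=> [X [XT XP XJ]|_ [v hv <-]]; last first.
  rewrite dhopf_half; split.
  - by rewrite [LHS]linearD /= trmxK addrC.
  - rewrite mulmxDl (mulmxDr (hopf z)) half_hopf // half_tr_hopf // hopf_half //.
    by rewrite hopf_half_tr // addr0 add0r.
  - by rewrite mulmxDl mulmxDr half_imx half_tr_imx.
have Pv : hopf z *m (X *m z) = 0.
  have := congr1 (mulmx^~ z) XP; rewrite /= mulmxDl -!mulmxA hopf_fix //.
  by move/(canRL (addKr _)); rewrite addNr.
exists (X *m z).
  have zJ : dot z (J *m z) = 0 by rewrite dotC dot_imxx.
  have Jz1 : dot (J *m z) (J *m z) = 1.
    by rewrite dot_imx imxK /dot mulmxN raddfN /= opprK.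
  have dot0 (u : C) : dot 0 u = 0 by rewrite /dot trmx0 mul0mx mxtrace0.
  rewrite hopf_mul in Pv; split.
    have := congr1 (dot^~ z) Pv.
    by rewrite dotDl !dotZl z1 dot_imxx mulr1 mulr0 addr0 dot0.
  have := congr1 (dot^~ (J *m z)) Pv.
  by rewrite dotDl !dotZl zJ Jz1 mulr1 mulr0 add0r dot0.
have hE : half z (X *m z) = X *m hopf z.
  by rewrite /half /hopf mulmxDr !mulmxA XJ.
by rewrite dhopf_half hE trmx_mul hopf_tr XT.
Qed.

Lemma fubini_study_dhopf (z v w : C) : dot z z = 1 ->
  horizontal z v -> horizontal z w ->
  fubini_study (dhopf z v) (dhopf z w) = dot v w.
Proof.
move=> z1 hv hw; rewrite /fubini_study !dhopf_half.
have AB0 : half z v *m half z w = 0.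
  by rewrite -(half_hopf v z1) -mulmxA hopf_half // mulmx0.
have AB0' : (half z v)^T *m (half z w)^T = 0.
  by rewrite -(hopf_half_tr w z1) mulmxA half_tr_hopf // mul0mx.
have EX (A B : ambient R n) :
    (A + A^T)^T *m (B + B^T) = A^T *m B + A^T *m B^T + (A *m B + A *m B^T).
  by rewrite [(_ + _)^T]linearD /= trmxK mulmxDl !mulmxDr.
rewrite EX AB0 AB0' addr0 add0r [\tr _]raddfD /=.
have -> : \tr (half z v *m (half z w)^T) = \tr ((half z v)^T *m half z w).
  by rewrite mxtrace_mulC -[LHS]mxtrace_tr !trmx_mul !trmxK.
suff -> : \tr ((half z v)^T *m half z w) = 2 * dot v w by field.
have E (a b c d : C) : \tr ((a *m b^T)^T *m (c *m d^T)) = dot a c * dot d b.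
  rewrite trmx_mul trmxK mulmxA -(mulmxA b) dot_scalar mul_mx_scalar.
  by rewrite -scalemxAl mxtraceZ mxtrace_mulC.
have JJ (a b : C) : dot (J *m a) (J *m b) = dot a b.
  by rewrite dot_imx imxK /dot mulmxN raddfN /= opprK.
rewrite /half [(_ + _)^T]linearD /= mulmxDl !mulmxDr !raddfD /= !E.
rewrite !JJ z1 dot_imxx [dot z (J *m z)]dotC dot_imxx; ring.
Qed.

Lemma JCP_dhopf (z v : C) : dot z z = 1 -> horizontal z v ->
  horizontal z (J *m v) /\ JCP (hopf z) (dhopf z v) = dhopf z (J *m v).
Proof.
move=> z1 hv; have [v0 v1] := hv; split.
  split; last by rewrite dot_imx imxK /dot mulmxN raddfN /= opprK.
  by have := dot_imx z v; rewrite v1 => /esym /eqP; rewrite oppr_eq0 => /eqP.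
have hJ : half z (J *m v) = J *m half z v.
  by rewrite /half mulmxDr !mulmxA.
rewrite /JCP !dhopf_half mulmxDl (mulmxDr (hopf z)) half_hopf // half_tr_hopf //.
rewrite hopf_half // hopf_half_tr // addr0 add0r hJ trmx_mul tr_imx mulmxN.
by rewrite half_tr_imx mulmxBr.
Qed.

End Hopf.

(* Main.v *)
Require Import Defs.
From mathcomp Require Import all_boot all_order all_algebra.
From mathcomp Require Import all_classical all_reals all_analysis.
From mathcomp Require Import perm ring lra zify.

Set Implicit Arguments.
Unset Strict Implicit.
Unset Printing Implicit Defensive.

Import Order.TTheory GRing.Theory Num.Theory.
Import numFieldNormedType.Exports.
Local Open Scope classical_set_scope.
Local Open Scope ring_scope.

(* Let p = [z] be a point of a leaf of maximal dimension and let v be a unit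
   normal vector there.  Since the normal spaces are complex lines and normal
   geodesics stay normal, the normal space of the foliation at every nearby
   point of the geodesic z_t = cos t z + sin t v is spanned by
   v_t = - sin t z + cos t v.  Let S_t be the shape operator at z_t in the
   direction v_t.  If a curve (z(s), v(s)) of normal frames along the leaf has
   initial velocity (a, b) with b = S_0 a, then (z(s)_t, v(s)_t) has initial
   velocity (cos t a + sin t b, - sin t a + cos t b), hence
     S_t (cos t a + sin t b) = - sin t a + cos t b
   (this integrates the Riccati equation S' = - S^2 - 1).  The leaves being
   complex, S_0 and S_t anticommute with i; so the frame of velocity
   (i a, - i b) gives S_t (cos t a - sin t b) = sin t a + cos t b.  As S_t is
   symmetric, these two equations yield
   sin t cos t (|a|^2 + |b|^2) = 0, which is absurd. *)

(** * Calculus *)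

Section Calculus.
Variables (R : realType) (V : normedModType R).

Lemma is_derive_mxP m n (M : V -> 'M[R]_(m, n)) x v dM :
  is_derive x v M dM <->
  forall i j, is_derive x v (fun y => M y i j) (dM i j).
Proof.
split=> [[Mx <-] i j|Mij].
  by split; [move: i j; exact/derivable_mxP|rewrite derive_mx// mxE].
have Mx : derivable M x v by apply/derivable_mxP => i j; exact: ex_derive.
split=> //; rewrite derive_mx//; apply/matrixP => i j; rewrite mxE.
exact: derive_val.
Qed.

Lemma is_derive_sumf (I : Type) (r : seq I) (P : pred I) (f : I -> V -> R)
    (df : I -> R) x v : (forall i, P i -> is_derive x v (f i) (df i)) ->
  is_derive x v (fun y => \sum_(i <- r | P i) f i y) (\sum_(i <- r | P i) df i).
Proof.
move=> fdf; have -> : (fun y => \sum_(i <- r | P i) f i y) = \sum_(i <- r | P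
  i) f i.
  by apply/funext => y; rewrite fct_sumE.
by elim/big_ind2 : _ => // [|*]; [exact: is_derive_cst|exact: is_deriveD].
Qed.

Lemma is_derive_mulmx m n p (A : V -> 'M[R]_(m, n)) (B : V -> 'M[R]_(n, p))
    x v dA dB : is_derive x v A dA -> is_derive x v B dB ->
  is_derive x v (fun y => A y *m B y) (dA *m B x + A x *m dB).
Proof.
move=> /is_derive_mxP Ax /is_derive_mxP Bx; apply/is_derive_mxP => i j.
under eq_fun do rewrite mxE; rewrite !mxE -big_split /=.
apply: is_derive_sumf => k _.
apply: (is_derive_eq (is_deriveM (Ax i k) (Bx k j))).
by rewrite addrC; congr (_ + _); exact: mulrC.
Qed.

Lemma is_derive_trmx m n (A : V -> 'M[R]_(m, n)) x v dA :
  is_derive x v A dA -> is_derive x v (fun y => (A y)^T) dA^T.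
Proof.
move=> /is_derive_mxP Ax; apply/is_derive_mxP => i j; rewrite mxE.
by under eq_fun do rewrite mxE.
Qed.

Lemma is_derive_dot n (f g : V -> 'cV[R]_(n.+1 + n.+1)) x v df dg :
  is_derive x v f df -> is_derive x v g dg ->
  is_derive x v (fun y => dot (f y) (g y)) (dot df (g x) + dot (f x) dg).
Proof.
move=> fx gx; have /is_derive_mxP/(_ 0 0) :=
  is_derive_mulmx (is_derive_trmx fx) gx.
have E (a b : 'cV[R]_(n.+1 + n.+1)) : dot a b = (a^T *m b) 0 0.
  by rewrite dot_scalar mxE eqxx.
by rewrite mxE !E; under [in X in _ -> X]eq_fun do rewrite E.
Qed.

Lemma derivable_det n (A : V -> 'M[R]_n) x v :
  (forall i j, derivable (fun y => A y i j) x v) ->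
  derivable (fun y => \det (A y)) x v.
Proof.
move=> Ad; rewrite /determinant.
have -> : (fun y => \sum_(s : 'S_n) (-1) ^+ s * \prod_i A y i (s i)) =
    \sum_(s : 'S_n) (cst ((-1) ^+ s) * \prod_i (fun y => A y i (s i))).
  apply/funext => y; rewrite fct_sumE; apply: eq_bigr => s _ /=.
  by rewrite [RHS]/(_ * _) fct_prodE.
elim/big_ind : _ => [|f g fd gd|s _]; [exact: derivable_cst|exact: derivableD|].
apply: derivableM; first exact: derivable_cst.
by elim/big_ind : _ => [|f g fd gd|//];
  [exact: derivable_cst|exact: derivableM].
Qed.

(** The entries of the adjugate are polynomials in those of the matrix. This makes Cramer's rule
    differentiable in [moving_solution]. *)
Lemma derivable_adjugate n (A : V -> 'M[R]_n) x v :
  derivable A x v -> derivable (fun y => \adj (A y)) x v.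
Proof.
move=> /derivable_mxP Ad; apply/derivable_mxP => i j.
under eq_fun do rewrite mxE /cofactor.
apply: derivableM; first exact: derivable_cst.
by apply: derivable_det => k l; under eq_fun do rewrite !mxE; exact: Ad.
Qed.

(** This turns an identity that holds along a curve into a linear equation on its initial
    velocity. *)
Lemma is_derive_near_cst (W : normedModType R) (f : V -> W) x v c df :
  (\near x, f x = c) -> is_derive x v f df -> df = 0.
Proof.
move=> fc [_ <-]; rewrite (near_eq_derive v (g := cst c)) //.
exact: derive_cst.
Qed.

Lemma is_derive_compR (W : normedModType R) (f : V -> W) (g : R -> V) t dg :
  differentiable f (g t) -> is_derive t 1 g dg ->
  is_derive t 1 (fun s => f (g s)) ('D_dg f (g t)).
Proof.
move=> fd gd; have gD : differentiable g t by apply/derivable1_diffP.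
have fgD : differentiable (f \o g) t by exact: differentiable_comp.
split; first exact/derivable1_diffP.
rewrite -[LHS]/('D_1 (f \o g) t) deriveE// diff_comp//= -deriveE//.
by rewrite -deriveE// derive_val.
Qed.

Lemma is_derive_line (x v : V) (t : R) :
  is_derive t 1 (fun s => x + s *: v) v.
Proof.
have -> : (fun s => x + s *: v) = cst x + ( *:%R^~ v) by apply/funext.
have d : is_derive t 1 ( *:%R^~ v) v.
  split; first by apply/derivable1_diffP; exact/ex_diff.
  by rewrite deriveE ?diff_val ?scale1r //; exact/ex_diff.
by apply: is_derive_eq; rewrite add0r.
Qed.

Lemma is_derive_comp_line (W : normedModType R) (f : V -> W) (x v : V) (t : R) :
  differentiable f (x + t *: v) ->
  is_derive t 1 (fun s => f (x + s *: v)) ('D_v f (x + t *: v)).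
Proof. move=> fd; apply: is_derive_compR => //; exact: is_derive_line. Qed.

End Calculus.

Section Smooth.
Variables (R : realType) (V W : normedModType R).
Implicit Types (U : set V) (f : V -> W).

Lemma smooth_differentiable U f x : smooth U f -> U x -> differentiable f x.
Proof. by move=> /(_ 1%N)[+ _] => /[apply]. Qed.

Lemma smooth_derive U f v : smooth U f -> smooth U ('D_v f).
Proof. by move=> fU k; have [_] := fU k.+1; exact. Qed.

Lemma smooth_continuous U f x : smooth U f -> U x -> {for x, continuous f}.
Proof. by move=> /(_ 0%N) + Ux => /(_ _ Ux). Qed.

End Smooth.

(** * Symmetry of second derivatives *)

Section Clairaut.
Variables (R : realType) (V : normedModType R).
Implicit Types (f : V -> R) (x v w : V).

Lemma mean_value_segment (g dg : R -> R) (h : R) : 0 < h ->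
  (forall t, 0 <= t <= h -> is_derive t 1 g (dg t)) ->
  exists2 t, 0 <= t <= h & g h - g 0 = h * dg t.
Proof.
move=> h0 gd; have [t||t + E] := @MVT _ g dg 0 h h0.
- by rewrite in_itv /= => /andP[t0 th]; apply: gd; rewrite !ltW.
- apply: derivable_within_continuous => t; rewrite in_itv /= => /gd ?.
  exact: ex_derive.
- rewrite in_itv /= => /andP[t0 th].
  by exists t; rewrite ?ltW// E subr0 mulrC.
Qed.

Lemma is_derive_along_line (W : normedModType R) (f : V -> W) x v t df :
  is_derive (x + t *: v) v f df -> is_derive t 1 (fun s => f (x + s *: v)) df.
Proof.
have E : (fun h : R => h^-1 *: (f (x + (h *: 1 + t) *: v) - f (x + t *: v))) =
    (fun h => h^-1 *: (f (h *: v + (x + t *: v)) - f (x + t *: v))).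
  by apply/funext => h; rewrite [h *: 1]mulr1 scalerDl addrCA.
by move=> [fd <-]; split; rewrite /derivable /derive /= E.
Qed.

(** The mean value theorem is used twice: on the increment of [f] in direction [w], as a function of
    [s], and then on [fv] along [w]. *)
Lemma second_difference f fv fvw x v w (h : R) : 0 < h ->
  (forall s t, 0 <= s <= h -> 0 <= t <= h ->
     let y := x + s *: v + t *: w in
     is_derive y v f (fv y) /\ is_derive y w fv (fvw y)) ->
  exists s t, [/\ 0 <= s <= h, 0 <= t <= h &
   f (x + h *: v + h *: w) - f (x + h *: w) - (f (x + h *: v) - f x) =
   h * (h * fvw (x + s *: v + t *: w))].
Proof.
move=> h0 fd; have h1 : 0 <= (0 : R) <= h by rewrite lexx ltW.
have h2 : 0 <= h <= h by rewrite lexx ltW.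
have [s sh|s sh Es] := @mean_value_segment
  (fun s => f (x + s *: v + h *: w) - f (x + s *: v))
  (fun s => fv (x + s *: v + h *: w) - fv (x + s *: v)) h h0.
  apply: is_deriveB.
    under eq_fun do rewrite addrAC.
    by apply: is_derive_along_line; rewrite addrAC; have [] := fd s h sh h2.
  apply: is_derive_along_line.
  by have [] := fd s 0 sh h1; rewrite scale0r addr0.
have [t th|t th Et] := @mean_value_segment (fun t => fv (x + s *: v + t *: w))
  (fun t => fvw (x + s *: v + t *: w)) h h0.
  by apply: is_derive_along_line; have [] := fd s t sh th.
exists s, t; split=> //; rewrite -Et scale0r addr0 -Es scale0r addr0.
have E (a b c d : R) : a - b - (c - d) = a - c - (b - d) by ring.
exact: E.
Qed.

(** The mean value theorem gives the two mixed derivatives at different intermediate points, so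
    equality is only available between values at distinct points close to [x]. *)
Lemma eq_near_values (A B : V -> R) x :
  {for x, continuous A} -> {for x, continuous B} ->
  (forall N, nbhs x N -> exists y z, [/\ N y, N z & A y = B z]) -> A x = B x.
Proof.
move=> /cvgrPdist_lt cA /cvgrPdist_lt cB AB.
apply/eqP; rewrite -subr_eq0; apply: contraT => N.
have e0 : 0 < `|A x - B x| / 2 by rewrite divr_gt0 ?normr_gt0.
have [y [z [[A1 _] [_ B1] E]]] := AB _ (filterI (cA _ e0) (cB _ e0)).
suff : `|A x - B x| < `|A x - B x| by rewrite ltxx.
rewrite [ltRHS]splitr; apply: le_lt_trans (ltrD A1 B1).
rewrite -(normrN (B x - _)) (le_trans _ (ler_normD _ _))// E opprB addrA.
by rewrite subrK.
Qed.

Lemma box_in_nbhs x v w (N : set V) : nbhs x N ->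
  exists2 h : R, 0 < h & forall s t, 0 <= s <= h -> 0 <= t <= h ->
    N (x + s *: v + t *: w).
Proof.
move=> /nbhs_normP[r /= r0 xr].
set M := `|v| + `|w| + 1; have M0 : 0 < M by rewrite ltr_wpDl ?addr_ge0.
have h0 : 0 < r / M / 2 by rewrite !divr_gt0.
exists (r / M / 2) => // s t /andP[s0 sh] /andP[t0 th]; apply: xr => /=.
rewrite -addrA opprD addNKr normrN.
apply: (le_lt_trans (ler_normD _ _)); rewrite !normrZ !ger0_norm//.
apply: (@le_lt_trans _ _ (r / M / 2 * (`|v| + `|w|))).
  by rewrite mulrDr lerD// ler_wpM2r.
apply: (@lt_le_trans _ _ (r / M / 2 * M)); first by rewrite ltr_pM2l// ltrDl.
by rewrite mulrAC divfK ?gt_eqF// ler_pdivrMr// ler_pMr// ler1n.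
Qed.

(** Both orders of differentiation compute the same second difference over a small parallelogram, so
    [fvw] and [fwv] share a value arbitrarily close to [x]. *)
Lemma mixed_derivatives_eq f fv fw fvw fwv x v w :
  (\forall y \near x, [/\ is_derive y v f (fv y), is_derive y w f (fw y),
     is_derive y w fv (fvw y) & is_derive y v fw (fwv y)]) ->
  {for x, continuous fvw} -> {for x, continuous fwv} -> fvw x = fwv x.
Proof.
move=> xd cvw cwv; apply: (@eq_near_values fvw fwv) => // N xN.
have [h h0 hb] := box_in_nbhs v w (filterI xd xN).
have [s t sh th|s [t [sh th E]]] := @second_difference f fv fvw x v w h h0.
  by have [[]] := hb _ _ sh th.
have [t' s' th' sh'|t' [s' [th' sh' E']]] := @second_difference f fw fwv x w v
  h h0.
  by rewrite addrAC; have [[]] := hb _ _ sh' th'.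
exists (x + s *: v + t *: w), (x + t' *: w + s' *: v); split.
- by have [_] := hb _ _ sh th.
- by rewrite addrAC; have [_] := hb _ _ sh' th'.
- apply: (mulfI (lt0r_neq0 h0)); apply: (mulfI (lt0r_neq0 h0)).
  rewrite -E -E' [x + _ + h *: v]addrAC.
  have A (a b c d : R) : a - b - (c - d) = a - c - (b - d) by ring.
  exact: A.
Qed.

End Clairaut.

Lemma clairaut (R : realType) (V : normedModType R) m n (U : set V)
    (f : V -> 'M[R]_(m, n)) x v w : open U -> U x -> smooth U f ->
  'D_v ('D_w f) x = 'D_w ('D_v f) x.
Proof.
move=> oU Ux fU.
have fv := smooth_derive v fU; have fw := smooth_derive w fU.
have dU (g : V -> 'M[R]_(m, n)) u y i j : smooth U g -> U y ->
    is_derive y u (fun z => g z i j) ('D_u g y i j).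
  move=> gU Uy; move: i j; apply/is_derive_mxP/derivableP/diff_derivable.
  exact: smooth_differentiable gU Uy.
have cU (g : V -> 'M[R]_(m, n)) i j : smooth U g ->
    {for x, continuous (fun z => g z i j)}.
  move=> gU; apply: (@continuous_comp _ _ _ g (fun M : 'M[R]_(m, n) => M i j)).
    exact: smooth_continuous gU Ux.
  exact: coord_continuous.
apply/matrixP => i j.
apply: (@mixed_derivatives_eq _ _ (fun z => f z i j) (fun z => 'D_w f z i j)
  (fun z => 'D_v f z i j) (fun z => 'D_v ('D_w f) z i j)
  (fun z => 'D_w ('D_v f) z i j) x w v).
- have nU : nbhs x U by exact: open_nbhs_nbhs.
  by apply: filterS nU => y Uy; split; exact: dU.
- exact: cU (smooth_derive v fw).
- exact: cU (smooth_derive w fv).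
Qed.

(** * Linear algebra *)

Section OrthogonalComplement.
Variables (R : realType) (N : nat).

Lemma mulmx_tr_eq0 m (A : 'M[R]_(m, N)) (x : 'cV[R]_N) :
  (A^T *m A) *m x = 0 -> A *m x = 0.
Proof.
move=> Ax; have : ((A *m x)^T *m (A *m x)) 0 0 = 0.
  by rewrite trmx_mul -mulmxA (mulmxA A^T) Ax mulmx0 mxE.
rewrite mxE => /eqP; rewrite psumr_eq0 => [/allP A0|i _]; last first.
  by rewrite mxE -expr2 sqr_ge0.
apply/colP => i; have := A0 i; rewrite mem_index_enum => /(_ isT) /=.
by rewrite !mxE -expr2 sqrf_eq0 => /eqP.
Qed.

Variables (d k : nat) (K : 'M[R]_(d, N)) (E : 'M[R]_(k, N)).
Hypotheses (EE : E *m E^T = 1%:M) (KE : K *m E^T = 0).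

Lemma row_free_col_mx : (forall w : 'rV_d, w *m K = 0 -> w = 0) ->
  row_free (col_mx K E).
Proof.
move=> K0; apply: inj_row_free => u.
rewrite -[u]hsubmxK mul_row_col => u0.
have r0 : rsubmx u = 0.
  have := congr1 (mulmx^~ E^T) u0.
  by rewrite /= mulmxDl -!mulmxA KE EE mulmx0 add0r mulmx1 mul0mx.
by rewrite r0 mul0mx addr0 in u0; rewrite r0 (K0 _ u0) row_mx0.
Qed.

(** By dimension count the rows of [K] and [E] together form a basis; pairing with the orthonormal
    rows of [E] shows that their coefficients in [x] vanish. *)
Lemma orthogonal_span : (d + k)%N = N ->
  (forall w : 'rV_d, w *m K = 0 -> w = 0) ->
  forall x : 'cV_N, E *m x = 0 -> exists w : 'rV_d, x = (w *m K)^T.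
Proof.
move=> dk K0 x Ex; have f := row_free_col_mx K0.
have : (x^T <= col_mx K E)%MS.
  by apply: submx_full; rewrite /row_full (eqP f) dk.
move=> /submxP[u xu]; exists (lsubmx u); apply: trmx_inj; rewrite trmxK.
rewrite -[u]hsubmxK mul_row_col in xu; rewrite xu.
suff -> : rsubmx u = 0 by rewrite mul0mx addr0.
have := congr1 (mulmx^~ E^T) xu.
by rewrite /= mulmxDl -!mulmxA KE EE mulmx0 add0r mulmx1 -trmx_mul Ex trmx0.
Qed.

Lemma orthogonal_trivial_leq :
  (forall x : 'cV[R]_N, K *m x = 0 -> E *m x = 0 -> x = 0) -> (N <= d + k)%N.
Proof.
move=> KE0; have f : row_free (col_mx K E)^T.
  apply: inj_row_free => x x0; apply: trmx_inj; rewrite trmx0.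
  have : col_mx K E *m x^T = 0 by apply: trmx_inj; rewrite trmx_mul trmxK trmx0.
  by rewrite mul_col_mx -col_mx0 => /eq_col_mx[]; exact: KE0.
by rewrite -[X in (X <= _)%N](eqP f) rank_leq_col.
Qed.

Lemma orthogonal_nontrivial : (d + k < N)%N ->
  exists x : 'cV[R]_N, [/\ x != 0, K *m x = 0 & E *m x = 0].
Proof.
move=> dk; apply: contrapT => H.
suff : (N <= d + k)%N by rewrite leqNgt dk.
apply: orthogonal_trivial_leq => x Kx Ex; apply/eqP; apply: contrapT => x0.
by apply: H; exists x; split=> //; apply/negP.
Qed.

End OrthogonalComplement.

(** * Hermitian orthonormal pairs and their rotations *)

Section Frames.
Variables (R : realType) (n : nat).
Local Notation C := ('cV[R]_(n.+1 + n.+1)).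
Local Notation J := (imx R n).
Implicit Types (v w x z : C) (P X : ambient R n).

Lemma dotDr v w x : dot v (w + x) = dot v w + dot v x.
Proof. by rewrite dotC dotDl !(dotC v). Qed.

Lemma dotZr a v w : dot v (a *: w) = a * dot v w.
Proof. by rewrite dotC dotZl dotC. Qed.

Lemma dotNl v w : dot (- v) w = - dot v w.
Proof. by rewrite -scaleN1r dotZl mulN1r. Qed.

Lemma dotNr v w : dot v (- w) = - dot v w.
Proof. by rewrite dotC dotNl dotC. Qed.

Lemma dot0l v : dot 0 v = 0.
Proof. by rewrite -(scale0r v) dotZl mul0r. Qed.

Lemma dot0r v : dot v 0 = 0.
Proof. by rewrite dotC dot0l. Qed.

Lemma dotxJx v : dot v (J *m v) = 0.
Proof. by rewrite dotC dot_imxx. Qed.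

Lemma dotJJ v w : dot (J *m v) (J *m w) = dot v w.
Proof. by rewrite dot_imx imxK dotNr opprK. Qed.

Lemma dot_tr X v w : X^T = X -> dot (X *m v) w = dot v (X *m w).
Proof. by move=> XT; rewrite /dot trmx_mul XT mulmxA. Qed.

Lemma mulmx_dot d (K : 'M[R]_(d, n.+1 + n.+1)) v j :
  (K *m v) j 0 = dot (row j K)^T v.
Proof. by rewrite /dot trmxK -row_mul /mxtrace big_ord1 !mxE. Qed.

(** A Hermitian orthonormal pair: [z] lifts a point of P^n to the unit sphere and [v] is the
    horizontal lift of a unit tangent vector there. *)
Definition frame z v :=
  [/\ dot z z = 1, dot v v = 1, dot z v = 0 & dot (J *m z) v = 0].

(** The Hermitian orthogonal complement of the pair. When [v] is normal to a leaf of complex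
    codimension 1, it is the horizontal lift of the tangent space of that leaf. *)
Definition perp z v x :=
  [/\ dot z x = 0, dot (J *m z) x = 0, dot v x = 0 & dot (J *m v) x = 0].

Lemma frame_imx z v : frame z v -> frame z (J *m v).
Proof.
move=> [zz vv zv Jzv]; split=> //; rewrite ?dotJJ//.
by have := dot_imx z v; rewrite Jzv => /esym /eqP; rewrite oppr_eq0 => /eqP.
Qed.

Lemma perp_imx z v x : perp z v x -> perp z v (J *m x).
Proof.
have E y : dot y (J *m x) = - dot (J *m y) x by rewrite dot_imx opprK.
by move=> [a b c d]; split; rewrite ?dotJJ ?E ?b ?d ?oppr0.
Qed.

Lemma perpD z v x y a b : perp z v x -> perp z v y ->
  perp z v (a *: x + b *: y).
Proof.
move=> [x1 x2 x3 x4] [y1 y2 y3 y4]; split; rewrite dotDr !dotZr.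
- by rewrite x1 y1 !mulr0 addr0.
- by rewrite x2 y2 !mulr0 addr0.
- by rewrite x3 y3 !mulr0 addr0.
- by rewrite x4 y4 !mulr0 addr0.
Qed.

Definition turn (c s : R) z v : C := c *: z + s *: v.

Lemma frame_turn c s z v : c ^+ 2 + s ^+ 2 = 1 -> frame z v ->
  frame (turn c s z v) (turn (- s) c z v).
Proof.
move=> cs fzv; have [zz vv zv Jzv] := fzv; have [_ _ zJv _] := frame_imx fzv.
have Jvz : dot (J *m v) z = 0 by rewrite dotC.
have vz : dot v z = 0 by rewrite dotC.
split; rewrite /turn ?mulmxDr -?scalemxAr !(dotDl, dotDr, dotZl, dotZr) ?zz ?vv
  ?zv ?vz
  ?Jzv ?Jvz ?dot_imxx; try ring; rewrite -[RHS]cs; ring.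
Qed.

(** A rotation is invertible, so the turned pair spans the same complex plane. Hence shape operators
    at different times of a normal geodesic act on one and the same space. *)
Lemma perp_turn c s z v : c ^+ 2 + s ^+ 2 = 1 ->
  perp (turn c s z v) (turn (- s) c z v) = perp z v.
Proof.
move=> cs; apply/funext => x; apply/propext;
  rewrite /perp /turn !mulmxDr -!scalemxAr.
have K (y w : R) : c * y + s * w = 0 -> - s * y + c * w = 0 -> y = 0 /\ w = 0.
  move=> p q; split; rewrite -[LHS]mul1r -cs.
    have -> : (c ^+ 2 + s ^+ 2) * y =
      c * (c * y + s * w) - s * (- s * y + c * w).
      by ring.
    by rewrite p q !mulr0 subr0.
  have -> : (c ^+ 2 + s ^+ 2) * w = s * (c * y + s * w) + c * (- s * y + c * w).
    by ring.
  by rewrite p q !mulr0 addr0.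
rewrite !dotDl !dotZl; split=> -[].
  move=> p q r t; have [-> ->] := K _ _ p r.
  by have [-> ->] := K _ _ q t; split.
by move=> -> -> -> ->; split; ring.
Qed.

Definition frame_mx z v : 'M[R]_(1 + 1 + (1 + 1), n.+1 + n.+1) :=
  col_mx (col_mx z^T (J *m z)^T) (col_mx v^T (J *m v)^T).

Lemma frame_mx_mulE z v x : frame_mx z v *m x =
  col_mx (col_mx (dot z x)%:M (dot (J *m z) x)%:M)
         (col_mx (dot v x)%:M (dot (J *m v) x)%:M).
Proof.
by rewrite /frame_mx mul_col_mx (mul_col_mx z^T) (mul_col_mx v^T) !dot_scalar.
Qed.

Lemma frame_mx_eq z v x z' v' x' :
  frame_mx z v *m x = frame_mx z' v' *m x' <->
  [/\ dot z x = dot z' x', dot (J *m z) x = dot (J *m z') x',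
      dot v x = dot v' x' & dot (J *m v) x = dot (J *m v') x'].
Proof.
rewrite !frame_mx_mulE; split=> [|[-> -> -> ->] //].
move=> /eq_col_mx[/eq_col_mx[a b] /eq_col_mx[c d]].
by split; [move: a|move: b|move: c|move: d];
  move=> /matrixP/(_ 0 0); rewrite !mxE !mulr1n.
Qed.

Lemma frame_mx_eq0 z v x : frame_mx z v *m x = 0 <-> perp z v x.
Proof.
rewrite -(mulmx0 _ (frame_mx z v)); split=> [/frame_mx_eq[]|[a b c d]].
  by rewrite !dot0r.
by apply/frame_mx_eq; rewrite !dot0r.
Qed.

Lemma frame_mxK z v : frame z v -> frame_mx z v *m (frame_mx z v)^T = 1%:M.
Proof.
move=> fzv; have [zz vv zv Jzv] := fzv; have [_ _ zJv JzJv] := frame_imx fzv.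
have := dotJJ z z; have := dotJJ v v; have := dotxJx z; have := dotxJx v.
rewrite /frame_mx; move: (J *m z) (J *m v) Jzv zJv JzJv => z' v'.
rewrite zz vv => Jzv zJv JzJv vJv zJz JvJv JzJz.
rewrite !tr_col_mx !trmxK !mul_col_row !dot_scalar.
rewrite (dotC z' z) (dotC v' v) (dotC v z) (dotC v' z) (dotC v z') (dotC v' z').
rewrite zz vv zv Jzv zJv JzJv vJv zJz JvJv JzJz !raddf0 -!(scalar_mx_block 1 1).
by rewrite !block_mx0 -(scalar_mx_block (1 + 1)).
Qed.

Lemma perp_mulmx_tr d (K : 'M[R]_(d, n.+1 + n.+1)) z v :
  (forall w : 'rV_d, perp z v (w *m K)^T) -> K *m (frame_mx z v)^T = 0.
Proof.
move=> Kp; apply: trmx_inj; rewrite trmx_mul trmxK trmx0.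
apply/matrixP => i j; have /frame_mx_eq0/matrixP/(_ i 0) := Kp (delta_mx 0 j).
by rewrite trmx_mul mulmxA trmx_delta -colE !mxE.
Qed.

End Frames.

(* The unit speed geodesic of P^n starting at [hopf z] in the direction v is
   [fun t => hopf (point z v t)]. *)
Local Notation point z v t := (turn (cos t) (sin t) z v).
Local Notation velocity z v t := (turn (- sin t) (cos t) z v).

(** * Linear systems depending differentiably on a parameter *)

Section MovingSystems.
Variable R : realType.

Lemma derivable_continuous (W : normedModType R) (f : R -> W) t :
  derivable f t 1 -> {for t, continuous f}.
Proof. by move=> /derivable1_diffP; exact: differentiable_continuous. Qed.

Lemma derivable_mulmx m n p (A : R -> 'M[R]_(m, n)) (B : R -> 'M[R]_(n, p)) t :
  derivable A t 1 -> derivable B t 1 -> derivable (fun s => A s *m B s) t 1.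
Proof.
by move=> /derivableP Ad /derivableP Bd; have [] := is_derive_mulmx Ad Bd.
Qed.

Lemma derivable_col_mx m1 m2 n (A : R -> 'M[R]_(m1, n)) (B : R -> 'M[R]_(m2,
  n)) t :
  derivable A t 1 -> derivable B t 1 -> derivable (fun s => col_mx (A s) (B s))
    t 1.
Proof.
move=> /derivable_mxP Ad /derivable_mxP Bd; apply/derivable_mxP => i j.
by under eq_fun do rewrite mxE; case: (fintype.split i) => l;
  [exact: Ad|exact: Bd].
Qed.

Lemma derivable_detmx n (A : R -> 'M[R]_n) t :
  derivable A t 1 -> derivable (fun s => \det (A s)) t 1.
Proof. by move=> /derivable_mxP; exact: derivable_det. Qed.

Lemma is_derive_scale n (k : R -> R) (f : R -> 'cV[R]_n) (t dk : R) (df :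
  'cV[R]_n) :
  is_derive t 1 k dk -> is_derive t 1 f df ->
  is_derive t 1 (fun s => k s *: f s) (dk *: f t + k t *: df).
Proof.
move=> kd /is_derive_mxP fd; apply/is_derive_mxP => i j.
under eq_fun do rewrite mxE; rewrite !mxE.
apply: (is_derive_eq (is_deriveM kd (fd i j))).
by rewrite addrC; congr (_ + _); exact: mulrC.
Qed.

Variables (k N : nat) (M : R -> 'M[R]_(k, N)) (t : R).
Hypotheses (Md : derivable M t 1) (Mt : forall x : 'cV_N, M t *m x = 0 ->
  x = 0).

(* The system M s y = e is solved by Cramer's rule for M(t)^T M(s), a square
   matrix that is positive definite at s = t. *)
Let T s := (M t)^T *m M s.

Let detT : \forall s \near t, \det (T s) != 0.
Proof.
have Td : derivable T t 1 by apply: derivable_mulmx => //; exact: derivable_cst.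
have := derivable_continuous (derivable_detmx Td).
suff : \det (T t) != 0 by move=> T0 Tc; apply: (cvgr_neq0 _ Tc).
rewrite -unitfE -unitmxE -unitmx_tr -row_free_unit; apply: inj_row_free => u.
rewrite trmx_mul trmxK => u0; apply: trmx_inj; rewrite trmx0; apply: Mt.
by apply: mulmx_tr_eq0; apply: trmx_inj; rewrite !trmx_mul !trmxK trmx0 u0.
Qed.

Lemma near_mulmx_inj : \forall s \near t, forall x : 'cV_N, M s *m x = 0 ->
  x = 0.
Proof.
apply: filterS detT => s; rewrite -unitfE -unitmxE => Ts x Msx.
by rewrite -[x]mul1mx -(mulVmx Ts) -!mulmxA Msx !mulmx0.
Qed.

Lemma moving_solution (e : 'cV[R]_k) : row_free (M t) ->
  exists y : R -> 'cV[R]_N,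
    [/\ derivable y t 1, M t *m y t = e & \forall s \near t, M s *m y s = e].
Proof.
move=> Mf; pose y s := (\det (T s))^-1 *: (\adj (T s) *m ((M t)^T *m e)).
have sol s : \det (T s) != 0 -> M s *m y s = e.
  (* Independence of the rows of [M t] makes [(M t)^T] injective, so it can be cancelled from the
     square system solved by [y]. *)
  move=> Ts; have Mt0 (x : 'cV_k) : (M t)^T *m x = 0 -> x = 0.
    move=> x0; apply: trmx_inj; apply: (row_free_inj Mf).
    by rewrite trmx0 mul0mx; apply: trmx_inj; rewrite trmx_mul trmxK x0 trmx0.
  apply/eqP; rewrite -subr_eq0; apply/eqP/Mt0; rewrite mulmxBr mulmxA -/(T s).
  rewrite /y -scalemxAr mulmxA mul_mx_adj mul_scalar_mx scalerA mulVf// scale1r.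
  exact: subrr.
exists y; split; last exact: filterS detT.
- have Td : derivable T t 1 by apply: derivable_mulmx => //;
  exact: derivable_cst.
  have /derivableP d1 : derivable (fun s => (\det (T s))^-1) t 1.
    by apply: derivableV; [exact: nbhs_singleton detT|exact: derivable_detmx].
  have /derivableP d2 : derivable (fun s => \adj (T s) *m ((M t)^T *m e)) t 1.
    apply: derivable_mulmx; last exact: derivable_cst.
    exact: derivable_adjugate.
  by have [] := is_derive_scale d1 d2.
- by apply: sol; exact: nbhs_singleton detT.
Qed.

End MovingSystems.

(** * Projective space *)

Section Projective.
Variables (R : realType) (n : nat).
Local Notation C := ('cV[R]_(n.+1 + n.+1)).
Local Notation J := (imx R n).
Implicit Types (v w x z : C) (P X : ambient R n).

Lemma hopf_unit z : dot z z = 1 -> hopf z *m z = z.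
Proof. by move=> z1; rewrite hopf_mul z1 dot_imxx scale1r scale0r addr0. Qed.

Lemma hopf_perp z x : dot z x = 0 -> dot (J *m z) x = 0 -> hopf z *m x = 0.
Proof. by move=> zx Jzx; rewrite hopf_mul zx Jzx !scale0r addr0. Qed.

Lemma hopf_fixed P x : CP R n P -> P *m x = x -> dot x x = 1 -> hopf x = P.
Proof.
rewrite CPE => -[y /= y1 <-{P}] yx x1; symmetry; apply/(hopf_eq y1 x1).
exists (dot y x), (dot (J *m y) x); split; last by rewrite -hopf_mul yx.
have := congr1 (fun u : 'cV_(n.+1 + n.+1) => dot u x) yx;
  rewrite /= x1 hopf_mul dotDl !dotZl -!expr2.
by [].
Qed.

(** Multiplication by [z] thus inverts [dhopf z]: below, [X *m z] is the horizontal lift at [z] of a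
    tangent vector [X]. *)
Lemma dhopf_unit z v : dot z z = 1 -> horizontal z v -> dhopf z v *m z = v.
Proof.
move=> z1 [zv Jzv]; have vz : dot v z = 0 by rewrite dotC.
have Jvz : dot (J *m v) z = 0 by rewrite dot_imx dotC Jzv oppr0.
rewrite /dhopf !mulmxDl -(mulmxA v) -(mulmxA z) -(mulmxA (J *m v)) -(mulmxA (J
  *m z)).
rewrite !dot_scalar z1 vz Jvz dot_imxx !mul_mx_scalar.
by rewrite scale1r !scale0r !addr0.
Qed.

Variables (z : C) (X : ambient R n).
Hypotheses (z1 : dot z z = 1) (tX : tangentCP (hopf z) X).

Lemma tangentCP_horizontal : horizontal z (X *m z) /\ dhopf z (X *m z) = X.
Proof.
by move: tX; rewrite tangentCPE// => -[v hv <-]; rewrite dhopf_unit.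
Qed.

(** A tangent vector exchanges the complex line of [z] and its complement, so its block on the
    complement vanishes. *)
Lemma tangentCP_hopf_perp v w : dot z v = 0 -> dot (J *m z) v = 0 ->
  dot z w = 0 -> dot (J *m z) w = 0 -> dot v (X *m w) = 0.
Proof.
move=> zv Jzv zw Jzw; have [_ XP _] := tX.
rewrite -{1}XP mulmxDl -!mulmxA (hopf_perp zw Jzw) mulmx0 add0r.
by rewrite -(dot_tr _ _ (hopf_tr z)) hopf_perp// dot0l.
Qed.

Lemma JCP_mul : JCP (hopf z) X *m z = J *m (X *m z).
Proof.
have [[zX JzX] _] := tangentCP_horizontal.
by rewrite /JCP -mulmxA mulmxBl -!mulmxA hopf_unit// hopf_perp// subr0.
Qed.

Lemma fubini_study_tangentCP v : horizontal z v ->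
  fubini_study (dhopf z v) X = dot v (X *m z).
Proof.
move=> hv; have [hX {1}<-] := tangentCP_horizontal.
exact: fubini_study_dhopf.
Qed.

End Projective.

Section ProjectiveCurves.
Variables (R : realType) (n : nat).
Local Notation C := ('cV[R]_(n.+1 + n.+1)).
Local Notation J := (imx R n).
Implicit Types (f : R -> C).

Lemma is_derive_mulmxl m p (A : 'M[R]_(p, m)) (f : R -> 'cV[R]_m) (t : R)
    (df : 'cV[R]_m) : is_derive t 1 f df ->
  is_derive t 1 (fun s => A *m f s) (A *m df).
Proof.
move=> fd; apply: (is_derive_eq (is_derive_mulmx (is_derive_cst A t 1) fd)).
by rewrite mul0mx add0r.
Qed.

Lemma is_derive_hopf f (t : R) (df : C) : is_derive t 1 f df ->
  is_derive t 1 (fun s => hopf (f s)) (dhopf (f t) df).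
Proof.
move=> fd; have Jd := is_derive_mulmxl J fd; rewrite /hopf.
apply: (is_derive_eq (is_deriveD (is_derive_mulmx fd (is_derive_trmx fd))
  (is_derive_mulmx Jd (is_derive_trmx Jd)))).
by rewrite /dhopf addrA.
Qed.

Definition normalize f s : C := (Num.sqrt (dot (f s) (f s)))^-1 *: f s.

Lemma dot_normalize f s : f s != 0 -> dot (normalize f s) (normalize f s) = 1.
Proof.
move=> f0; have N : 0 < dot (f s) (f s).
  by rewrite lt_def dot_ge0 andbT; apply: contra_neq f0; exact: dot_eq0.
rewrite /normalize dotZl dotZr mulrA -expr2 exprVn sqr_sqrtr ?ltW//.
by rewrite mulVf// gt_eqF.
Qed.

Lemma normalize_unit f s : dot (f s) (f s) = 1 -> normalize f s = f s.
Proof. by move=> f1; rewrite /normalize f1 sqrtr1 invr1 scale1r. Qed.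

Lemma is_derive_normalize f (t : R) (df : C) : dot (f t) (f t) = 1 ->
  is_derive t 1 f df ->
  is_derive t 1 (normalize f) (df - dot (f t) df *: f t).
Proof.
move=> f1 fd; have dd := is_derive_dot fd fd.
have sd : is_derive t 1 (fun s => Num.sqrt (dot (f s) (f s))) (dot (f t) df).
  have sq : is_derive (dot (f t) (f t)) 1 (@Num.sqrt R) 2^-1.
    rewrite f1; apply: is_derive_eq; first exact: is_derive1_sqrt.
    by rewrite sqrtr1 mulr1.
  apply: (is_derive_eq (is_derive1_comp sq dd)).
  by rewrite (dotC df); field.
have vd : is_derive t 1 (fun s => (Num.sqrt (dot (f s) (f s)))^-1)
  (- dot (f t) df).
  apply: (is_derive_eq (is_deriveV _ sd)); first by rewrite f1 sqrtr1.
  by rewrite f1 sqrtr1 expr1n invr1 [_ *: _]mulN1r.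
apply: (is_derive_eq (is_derive_scale vd fd)).
by rewrite f1 sqrtr1 invr1 scale1r scaleNr addrC.
Qed.

Lemma near_neq0 (W : normedModType R) (f : R -> W) (t : R) :
  derivable f t 1 -> f t != 0 -> \forall s \near t, f s != 0.
Proof. by move=> /derivable_continuous fc; exact: (cvgr_neq0 _ fc). Qed.

End ProjectiveCurves.

(** * Leaves and their shape operators *)

Section Submanifolds.
Variable R : realType.

Lemma derive_rV (W : normedModType R) d (f : 'rV[R]_d -> W) u w :
  differentiable f u -> 'D_w f u = \sum_j w 0 j *: 'D_(delta_mx 0 j) f u.
Proof.
move=> fd; rewrite deriveE// [in LHS](row_sum_delta w) linear_sum.
by apply: eq_bigr => j _; rewrite linearZ deriveE.
Qed.

Variables (W : normedModType R) (L : submanifold W).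

Lemma chart_differentiable i u : chart_dom L i u ->
  differentiable (chart L i) u.
Proof. exact: smooth_differentiable (@chart_smooth _ _ L i). Qed.

Lemma chart_near i u : chart_dom L i u -> \forall x \near u, chart_dom L i x.
Proof. by move=> Du; apply: open_nbhs_nbhs; split=> //; exact: chart_open. Qed.

(** [tangent] admits any chart through the point; the transition map and the chain rule carry the
    vector into the given chart. *)
Lemma tangent_chart i u X : chart_dom L i u -> tangent L (chart L i u) X ->
  exists w, X = 'D_w (chart L i) u.
Proof.
move=> Du [j [u' [Du' E [w <-]]]].
have [oD [tau tauS tauE]] := @chart_compat _ _ L j i.
set D := _ `&` _ in oD tauS tauE.
have DDu' : D u' by split=> //; exists u.
have tu : tau u' = u.
  have [d1 d2] := tauE _ DDu'.
  by apply: (@chart_inj _ _ L i); rewrite ?inE// d2.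
have td : differentiable tau u' by exact: smooth_differentiable tauS DDu'.
exists ('D_w tau u').
have cd : differentiable (chart L i) (tau u').
  by rewrite tu; exact: chart_differentiable.
rewrite -[in RHS]tu -[RHS]/('D_('D_w tau u') (chart L i) (tau u')).
transitivity ('D_w (chart L i \o tau) u').
  apply: near_eq_derive; apply: filterS (open_nbhs_nbhs (conj oD DDu')) => x Dx.
  by have [_] := tauE _ Dx.
rewrite deriveE; last exact: differentiable_comp.
by rewrite diff_comp// /= -!deriveE.
Qed.

Lemma chart_tangent i u w : chart_dom L i u ->
  tangent L (chart L i u) ('D_w (chart L i) u).
Proof. by move=> Du; exists i, u; split=> //; exists w. Qed.

End Submanifolds.

Section Leaves.
Variables (R : realType) (n : nat) (O : set (ambient R n)) (F : foliation O).
Hypothesis OCP : O `<=` CP R n.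
Local Notation C := ('cV[R]_(n.+1 + n.+1)).
Local Notation J := (imx R n).
Implicit Types (v w x z : C) (P X : ambient R n).

Lemma leaf_sub a P : points (leaf F a) P -> O P.
Proof. by move=> aP; rewrite -(leaf_cover F); exists a. Qed.

Lemma leaf_chart_sub a i u : chart_dom (leaf F a) i u ->
  O (chart (leaf F a) i u).
Proof. by move=> Du; apply: (@leaf_sub a); exists i, u. Qed.

Lemma leaf_exists P : O P -> exists a, points (leaf F a) P.
Proof.
move=> OP; have [a _ aP] : (\bigcup_a points (leaf F a)) P.
  by rewrite leaf_cover.
by exists a.
Qed.

(** The charts take values in P^n, so the matrix equations defining [CP] can be differentiated along
    them. *)
Lemma leaf_tangentCP a P X : tangent (leaf F a) P X -> tangentCP P X.
Proof.
move=> [i [u [Du <- [w <-]]]]; set f : _ -> ambient R n := chart (leaf F a) i.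
have fd : is_derive u w f ('D_w f u).
  by apply/derivableP/diff_derivable; exact: chart_differentiable.
have fCP : \forall x \near u, CP R n (f x).
  by apply: filterS (chart_near Du) => x Dx; exact/OCP/leaf_chart_sub.
have Jc : is_derive u w (fun=> J) 0 by exact: is_derive_cst.
have cst0 (g : 'rV[R]_(sdim (leaf F a)) -> ambient R n) (dg : ambient R n) :
    (forall y, CP R n (f y) -> g y = 0) -> is_derive u w g dg -> dg = 0.
  by move=> g0 gd; apply: (is_derive_near_cst (c := 0) _ gd);
    exact: filterS fCP.
split; apply/eqP; rewrite -subr_eq0; apply/eqP.
- apply: (cst0 (fun y => (f y)^T - f y)) => [y [-> _ _ _]|]; first exact: subrr.
  exact: is_deriveB (is_derive_trmx fd) fd.
- apply: (cst0 (fun y => f y *m f y - f y)) => [y [_ -> _ _]|];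
  first exact: subrr.
  exact: is_deriveB (is_derive_mulmx fd fd) fd.
- apply: (cst0 (fun y => f y *m J - J *m f y)) => [y [_ _ -> _]|].
    exact: subrr.
  apply: (is_derive_eq (is_deriveB (is_derive_mulmx fd Jc)
    (is_derive_mulmx Jc fd))).
  by rewrite mulmx0 mul0mx addr0 add0r.
Qed.

(** For horizontal [v], the product [dot v (X *m z)] is the Fubini-Study product of [dhopf z v] with
    [X], by [fubini_study_tangentCP]. *)
Definition normal_at z v :=
  forall a X, points (leaf F a) (hopf z) -> tangent (leaf F a) (hopf z) X ->
    dot v (X *m z) = 0.

Lemma normal_imx z v : complex_foliation F -> dot z z = 1 -> normal_at z v ->
  normal_at z (J *m v).
Proof.
move=> cF z1 nv a X aP aX; have := nv a _ aP (cF _ _ aP _ aX).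
rewrite JCP_mul//; last exact: leaf_tangentCP aX.
by rewrite dot_imx => ->; rewrite oppr0.
Qed.

(** Disjointness leaves a single leaf to consider, and linearity reduces its tangent vectors to the
    coordinate vectors of one chart. *)
Lemma normal_rangeP a i u z v : chart_dom (leaf F a) i u ->
  chart (leaf F a) i u = hopf z ->
  normal_at z v <->
  forall j, dot v ('D_(delta_mx 0 j) (chart (leaf F a) i) u *m z) = 0.
Proof.
move=> Du uz; split=> [nv j|nv b X bz bX].
  apply: (nv a); first by exists i, u.
  by rewrite -uz; exact: chart_tangent.
have ab : b = a by apply: (leaf_disjoint bz); exists i, u.
rewrite {}ab -uz in bX; have [w ->] := tangent_chart Du bX.
rewrite derive_rV; last exact: chart_differentiable.
rewrite mulmx_suml /dot mulmx_sumr raddf_sum big1//= => j _.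
by rewrite -scalemxAl -scalemxAr mxtraceZ [X in _ * X]nv mulr0.
Qed.

End Leaves.

(** * Normal frames along a leaf and its second fundamental form *)

Section LeafCurves.
Variables (R : realType) (n : nat) (O : set (ambient R n)) (F : foliation O).
Hypotheses (OCP : O `<=` CP R n) (cF : complex_foliation F).
Local Notation C := ('cV[R]_(n.+1 + n.+1)).
Local Notation J := (imx R n).

Definition normal_frame (z v : C) :=
  [/\ frame z v, O (hopf z) & normal_at F z v].

(** The base curve is not asked to stay in a leaf: only the initial velocities and the normality
    matter, and these are what can be transported along geodesics. *)
Definition normal_curve (z v a b : C) := exists zs vs : R -> C,
  [/\ zs 0 = z, vs 0 = v, is_derive (0 : R) 1 zs a, is_derive (0 : R) 1 vs b &
      \forall s \near (0 : R), normal_frame (zs s) (vs s)].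

Variables (a0 : leaf_idx F) (i : nat).
Local Notation L := (leaf F a0).
Local Notation d := (sdim L).
Let phi : 'rV[R]_d -> ambient R n := chart L i.
Variables (u : 'rV[R]_d) (z : C).
Hypotheses (Du : chart_dom L i u) (uz : phi u = hopf z) (z1 : dot z z = 1).
(** The horizontal lift at [z] of the tangent vector with coordinates [w]; the rows of [K] are the
    lifts of the coordinate vectors. *)
Let A (w : 'rV[R]_d) : C := 'D_w phi u *m z.
Let K : 'M[R]_(d, n.+1 + n.+1) := \matrix_j (A (delta_mx 0 j))^T.

Let AK w : A w = (w *m K)^T.
Proof.
apply: trmx_inj; rewrite trmxK mulmx_sum_row /A derive_rV;
  last exact: chart_differentiable.
rewrite mulmx_suml linear_sum; apply: eq_bigr => j _ /=.
by rewrite rowK -scalemxAl linearZ.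
Qed.

Let tanphi w : tangentCP (hopf z) ('D_w phi u).
Proof. by rewrite -uz; apply: (leaf_tangentCP OCP (a := a0));
  exact: chart_tangent. Qed.

Let A_inj w : A w = 0 -> w = 0.
Proof.
move=> Aw; apply: (chart_immersion Du).
have [_ <-] := tangentCP_horizontal z1 (tanphi w).
by rewrite -/(A w) Aw /dhopf !(mulmx0, mul0mx, trmx0) !addr0.
Qed.

Lemma leaf_normal_exists : (d + 2 < n.+1 + n.+1)%N -> 
  exists v, frame z v /\ normal_at F z v.
Proof.
move=> dn; pose E := col_mx z^T (J *m z)^T.
have Ezero x : E *m x = 0 <-> dot z x = 0 /\ dot (J *m z) x = 0.
  rewrite /E mul_col_mx !dot_scalar; split=> [|[-> ->]];
    last by rewrite raddf0 col_mx0.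
  rewrite -(col_mx0 _ 1 1) => /eq_col_mx[a b].
  by split; [move: a|move: b]; move=> /matrixP/(_ 0 0); rewrite !mxE mulr1n.
have [x [x0 Kx /Ezero[zx Jzx]]] := orthogonal_nontrivial K E dn.
pose v := normalize (fun=> x) 0; exists v.
have v1 : dot v v = 1 by apply: dot_normalize.
split; first by split; rewrite // /v /normalize dotZr ?zx ?Jzx mulr0.
apply: (normal_rangeP v Du uz).2 => j; rewrite /v /normalize dotZl.
have := congr1 (fun M : 'cV_d => M j 0) Kx.
by rewrite /= mulmx_dot rowK trmxK mxE (dotC x) => ->; rewrite mulr0.
Qed.

Variable v : C.
Hypotheses (fzv : frame z v) (nzv : normal_at F z v) (dn : (d + 4)%N =
  (n.+1 + n.+1)%N).

Let A_perp w : perp z v (A w).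
Proof.
have uL : points L (hopf z) by exists i, u.
have tL : tangent L (hopf z) ('D_w phi u) by rewrite -uz; exact: chart_tangent.
have [[? ?] _] := tangentCP_horizontal z1 (tanphi w).
by split=> //; [exact: (nzv uL tL)|exact: (normal_imx OCP cF z1 nzv uL tL)].
Qed.

Let A_onto x : perp z v x -> exists w, x = A w.
Proof.
move=> /frame_mx_eq0 px.
have KE : K *m (frame_mx z v)^T = 0.
  by apply: perp_mulmx_tr => w; rewrite -AK; exact: A_perp.
have K0 (w : 'rV_d) : w *m K = 0 -> w = 0.
  by move=> wK; apply: A_inj; rewrite AK wK trmx0.
have [w ->] := orthogonal_span (frame_mxK fzv) KE dn K0 px.
by exists w; rewrite AK.
Qed.

Lemma leaf_span x : perp z v x -> (forall w, dot (A w) x = 0) -> x = 0.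
Proof. by move=> /A_onto[w ->] /(_ w); exact: dot_eq0. Qed.

Section OneDirection.
Variable w : 'rV[R]_d.

(** The matrix [phi (u + s *: w)] projects onto the complex line it represents, so the normalized
    image of [z] lifts the curve in the leaf to the unit sphere. *)
Let g (s : R) : C := phi (u + s *: w) *m z.
Let zs := normalize g.

Let g0 : g 0 = z.
Proof. by rewrite /g scale0r addr0 uz hopf_unit. Qed.

Let zs0 : zs 0 = z.
Proof. by rewrite /zs normalize_unit g0. Qed.

Let Ds : \forall s \near (0 : R), chart_dom L i (u + s *: w).
Proof.
have : derivable (fun s : R => u + s *: w) 0 1 by have [] :=
  is_derive_line u w 0.
move=> /derivable_continuous uc; apply: uc.
by rewrite scale0r addr0; exact: chart_near.
Qed.

Let phi_derive w' : is_derive (0 : R) 1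
  (fun s => 'D_w' phi (u + s *: w)) ('D_w ('D_w' phi) u).
Proof.
have := @is_derive_comp_line _ _ _ ('D_w' phi) u w 0.
rewrite scale0r addr0; apply; apply: smooth_differentiable Du.
by apply: smooth_derive; exact: chart_smooth.
Qed.

Let zsd : is_derive (0 : R) 1 zs (A w).
Proof.
have pd : is_derive (0 : R) 1 (fun s => phi (u + s *: w)) ('D_w phi u).
  have := @is_derive_comp_line _ _ _ phi u w 0.
  by rewrite scale0r addr0; apply; exact: chart_differentiable.
have gd : is_derive (0 : R) 1 g (A w).
  have zd : is_derive (0 : R) 1 (fun=> z) 0 by exact: is_derive_cst.
  have := is_derive_mulmx pd zd; rewrite mulmx0 addr0; exact.
have := is_derive_normalize _ gd; rewrite g0 => /(_ z1).
by have [-> _ _ _] := A_perp w; rewrite scale0r subr0.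
Qed.

Let zs_lift : \forall s \near (0 : R),
  dot (zs s) (zs s) = 1 /\ hopf (zs s) = phi (u + s *: w).
Proof.
have gn0 : g 0 != 0.
  by apply/eqP => gz; move: z1; rewrite -g0 gz dot0l => /esym/eqP;
    rewrite oner_eq0.
have gD : derivable g 0 1.
  apply: derivable_mulmx; last exact: derivable_cst.
  have := @is_derive_comp_line _ _ _ phi u w 0.
  rewrite scale0r addr0 => H; have [] // := H _; exact: chart_differentiable.
apply: filterS2 Ds (near_neq0 gD gn0) => s Dus gs.
have P := OCP (leaf_chart_sub Dus); have zs1 := dot_normalize gs.
split=> //; apply: hopf_fixed => //.
by rewrite /zs /normalize -scalemxAr /g mulmxA; have [_ -> _ _] := P.
Qed.

Lemma leaf_curve : exists b, [/\ perp z v b, normal_curve z v (A w) b,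
  forall w', dot b (A w') = - dot v ('D_w ('D_w' phi) u *m z) &
  forall w', dot (J *m b) (A w') = - dot (J *m v) ('D_w ('D_w' phi) u *m z)].
Proof.
pose Ks s : 'M[R]_(d, n.+1 + n.+1) :=
  \matrix_j ('D_(delta_mx 0 j) phi (u + s *: w) *m zs s)^T.
(* The system [M s *m y = M 0 *m v] makes [y] normal to the leaf and horizontal at [zs s]. The fixed
   rows of [v] and [J *m v] single out one vector of the normal complex line. *)
pose M s := col_mx (Ks s) (frame_mx (zs s) v).
have M0 : M 0 = col_mx K (frame_mx z v).
  by rewrite /M /Ks /K zs0 scale0r addr0.
have KE : K *m (frame_mx z v)^T = 0.
  by apply: perp_mulmx_tr => w'; rewrite -AK; exact: A_perp.
have K0 (w' : 'rV_d) : w' *m K = 0 -> w' = 0.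
  by move=> wK; apply: A_inj; rewrite AK wK trmx0.
have Mfree : row_free (M 0).
  by rewrite M0; apply: row_free_col_mx; first exact: frame_mxK.
have Minj (x : C) : M 0 *m x = 0 -> x = 0.
  move=> x0; have : row_full (M 0) by rewrite /row_full (eqP Mfree); exact/eqP.
  move=> /row_fullP[B BM].
  by rewrite -[x]mul1mx -BM -mulmxA x0 mulmx0.
have zsD : derivable zs 0 1 by case: zsd => ? _.
have Md : derivable M 0 1.
  apply: derivable_col_mx.
    apply/derivable_mxP => j k; under eq_fun do rewrite 2!mxE.
    have : derivable (fun s : R => 'D_(delta_mx 0 j) phi (u + s *: w) *m zs s)
      0 1.
      by apply: derivable_mulmx => //; have [] := phi_derive (delta_mx 0 j).
    by move=> /derivable_mxP/(_ k 0).
  apply: derivable_col_mx; last exact: derivable_cst.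
  have zT : derivable (fun s : R => (zs s)^T) 0 1 by have [] :=
    is_derive_trmx zsd.
  apply: derivable_col_mx; first exact: zT.
  by have [] := is_derive_trmx (is_derive_mulmxl J zsd).
have [y [yd y0 ys]] := moving_solution Md Minj (M 0 *m v) Mfree.
have {}y0 : y 0 = v.
  by apply/eqP; rewrite -subr_eq0; apply/eqP/Minj; rewrite mulmxBr y0 subrr.
have [zz vv zv Jzv] := fzv; have Jvv : dot (J *m v) v = 0 by exact: dot_imxx.
have v0 w' : dot v (A w') = 0 by have [] := A_perp w'.
have yP : \forall s \near (0 : R), [/\ dot (zs s) (y s) = 0,
    dot (J *m zs s) (y s) = 0, dot v (y s) = 1, dot (J *m v) (y s) = 0 &
    forall j, dot (y s) ('D_(delta_mx 0 j) phi (u + s *: w) *m zs s) = 0].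
  apply: filterS ys => s;
    rewrite M0 /M (mul_col_mx (Ks s)) (mul_col_mx K) => /eq_col_mx[Ky].
  move=> /frame_mx_eq; rewrite zv Jzv vv Jvv => -[? ? ? ?]; split=> // j.
  have := congr1 (fun Q : 'cV_d => Q j 0) Ky.
  by rewrite /= !mulmx_dot !rowK !trmxK => Kyj; rewrite dotC Kyj dotC v0.
pose vs := normalize y.
have vs0 : vs 0 = v by rewrite /vs normalize_unit y0.
have vsn : \forall s \near (0 : R), normal_frame (zs s) (vs s) /\
    dot (J *m v) (vs s) = 0.
  apply: filterS3 Ds zs_lift yP => s Dus [zs1 hz] [zy Jzy vy Jvy ny].
  have yn0 : y s != 0.
    by apply/eqP => yz; move: vy; rewrite yz dot0r => /esym/eqP;
      rewrite oner_eq0.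
  have vs1 : dot (vs s) (vs s) = 1 by exact: dot_normalize.
  split; last by rewrite /vs /normalize dotZr Jvy mulr0.
  split; first by split; rewrite // /vs /normalize dotZr ?zy ?Jzy mulr0.
    by rewrite hz; exact: leaf_chart_sub.
  apply: (normal_rangeP _ Dus (esym hz)).2 => j.
  by rewrite /vs /normalize dotZl [X in _ * X]ny mulr0.
have [b vsd] : exists b, is_derive (0 : R) 1 vs b.
  have yD : is_derive (0 : R) 1 y ('D_1 y 0) by exact: derivableP.
  eexists; apply: (is_derive_normalize _ yD); by rewrite y0.
(* Each identity satisfied by the frames near time 0 is differentiated there; the results are the
   conditions on the velocity [b]. *)
have vanish (h : R -> R) dh : (forall s, normal_frame (zs s) (vs s) ->
    dot (J *m v) (vs s) = 0 -> chart_dom L i (u + s *: w) ->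
    phi (u + s *: w) = hopf (zs s) -> h s = 0) ->
    is_derive (0 : R) 1 h dh -> dh = 0.
  move=> h0; apply: is_derive_near_cst.
  by apply: filterS3 Ds zs_lift vsn => s ? [_ /esym ?] [? ?]; exact: h0.
have unit_vanish (h : R -> R) dh : (forall s, normal_frame (zs s) (vs s) -> h s
  = 1) ->
    is_derive (0 : R) 1 h dh -> dh = 0.
  move=> h1; apply: is_derive_near_cst.
  by apply: filterS vsn => s [? _]; exact: h1.
have JvsD := is_derive_mulmxl J vsd; have JzsD := is_derive_mulmxl J zsd.
have [zA JzA vA JvA] := A_perp w.
have pb : perp z v b.
  split.
  - have := vanish _ _ _ (is_derive_dot zsd vsd);
    rewrite vs0 zs0 (dotC _ v) vA add0r.
    by apply=> s [[]].
  - have := vanish _ _ _ (is_derive_dot JzsD vsd); rewrite vs0 zs0.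
    by rewrite (dot_imx (A w)) (dotC (A w)) JvA oppr0 add0r; apply=> s [[]].
  - have := unit_vanish _ _ _ (is_derive_dot vsd vsd);
    rewrite vs0 (dotC b) => H.
    have : dot v b + dot v b = 0 by apply: H => s [[]].
    by move: (dot v b) => c; lra.
  (* [vs] was chosen orthogonal to the fixed vector [J *m v], which excludes a rotation of [v]
     within the normal line. *)
  - have cJ : is_derive (0 : R) 1 (fun=> J *m v) 0 by exact: is_derive_cst.
    have := vanish _ _ _ (is_derive_dot cJ vsd); rewrite dot0l add0r.
    by apply.
(* The motion of [zs] contributes only a vector in the complex line of [z], invisible to [v]; the
   second derivative of the chart is all that remains. *)
have tan0 w' Y : dot v (Y + 'D_w' phi u *m A w) = dot v Y.
  rewrite dotDr -[RHS]addr0; congr (_ + _).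
  exact: (tangentCP_hopf_perp (tanphi w')).
have tanJ0 w' Y : dot (J *m v) (Y + 'D_w' phi u *m A w) = dot (J *m v) Y.
  rewrite dotDr -[RHS]addr0; congr (_ + _).
  have [_ _ zJv JzJv] := frame_imx fzv.
  exact: (tangentCP_hopf_perp (tanphi w')).
have nD w' : exists q : R -> C,
    [/\ forall s, q s = 'D_w' phi (u + s *: w) *m zs s, q 0 = A w' &
    is_derive (0 : R) 1 q ('D_w ('D_w' phi) u *m z + 'D_w' phi u *m A w)].
  have Du0 : 'D_w' phi (u + 0 *: w) = 'D_w' phi u by rewrite scale0r addr0.
  exists (fun s => 'D_w' phi (u + s *: w) *m zs s); split; first by move=> s.
    by rewrite zs0 Du0.
  by have := is_derive_mulmx (phi_derive w') zsd; rewrite zs0 Du0.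
exists b; split=> //.
- exists zs, vs; split=> //.
  by apply: filterS vsn => s [].
- move=> w'.
  have [q [qE q0 qd]] := nD w'.
  have := vanish _ _ _ (is_derive_dot vsd qd).
  rewrite q0 vs0 tan0 => H.
  apply/eqP; rewrite -addr_eq0; apply/eqP/H => s [_ _ ns] _ Dus us; rewrite qE.
  apply: (ns a0); first by exists i, (u + s *: w).
  by rewrite -us; exact: chart_tangent.
- move=> w'.
  have [q [qE q0 qd]] := nD w'.
  have := vanish _ _ _ (is_derive_dot JvsD qd).
  rewrite q0 vs0 tanJ0 => H.
  apply/eqP; rewrite -addr_eq0; apply/eqP/H => s [[zs1 _ _ _] _ ns] _ Dus us;
    rewrite qE.
  apply: (normal_imx OCP cF zs1 ns (a := a0)); first by exists i, (u + s *: w).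
  by rewrite -us; exact: chart_tangent.
Qed.

End OneDirection.

(* Clairaut's theorem makes the real and the imaginary part of the second
   fundamental form symmetric; together this means that the shape operator is
   symmetric and anticommutes with the complex structure. *)
Lemma shape_operator : exists S : C -> C,
  [/\ forall a, perp z v a -> perp z v (S a) /\ normal_curve z v a (S a),
      forall a a', perp z v a -> perp z v a' -> dot (S a) a' = dot a (S a') &
      forall a, perp z v a -> S (J *m a) = - (J *m S a)].
Proof.
have [S SP] : {S : C -> C & forall a, perp z v a -> exists w,
    [/\ a = A w, perp z v (S a), normal_curve z v a (S a),
    forall w', dot (S a) (A w') = - dot v ('D_w ('D_w' phi) u *m z) &
    forall w', dot (J *m S a) (A w') =
      - dot (J *m v) ('D_w ('D_w' phi) u *m z)]}.
  apply: (@boolp.choice C C (fun a b => perp z v a -> exists w, [/\ a = A w,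
    perp z v b,
    normal_curve z v a b,
    forall w', dot b (A w') = - dot v ('D_w ('D_w' phi) u *m z) &
    forall w', dot (J *m b) (A w') =
      - dot (J *m v) ('D_w ('D_w' phi) u *m z)])).
  (* Outside [perp z v] the operator gets the default value 0. *)
  move=> a; have [/A_onto[w ->]|] := pselect (perp z v a); last by exists 0.
  by have [b [? ? ? ?]] := leaf_curve w; exists b => _; exists w; split.
have swap w w' : 'D_w ('D_w' phi) u = 'D_w' ('D_w phi) u.
  exact: clairaut (@chart_open _ _ L i) Du (@chart_smooth _ _ L i).
have sym a a' : perp z v a -> perp z v a' -> dot (S a) a' = dot a (S a').
  move=> /SP[w [aw _ _ Sa _]] /SP[w' [aw' _ _ Sa' _]].
  by rewrite (dotC a) {1}aw' Sa aw Sa' swap.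
have symJ a a' : perp z v a -> perp z v a' -> dot (J *m S a) a' =
  dot a (J *m S a').
  move=> /SP[w [aw _ _ _ Sa]] /SP[w' [aw' _ _ _ Sa']].
  by rewrite (dotC a) {1}aw' Sa aw Sa' swap.
exists S; split=> // [a /SP[w [_ pS cS _ _]] //|a pa].
have pJa := perp_imx pa; have pSa : perp z v (S a) by have [? []] := SP _ pa.
have pSJa : perp z v (S (J *m a)) by have [? []] := SP _ pJa.
(* The square norm of [y] is 0: by symmetry of both forms, moving [S] and [J *m S] onto [y] leaves
   two opposite terms. *)
pose y := S (J *m a) + J *m S a.
have py : perp z v y.
  by rewrite /y -[S _]scale1r -[J *m S a]scale1r; apply: perpD => //;
    exact: perp_imx.
suff : y = 0 by move=> /eqP; rewrite addr_eq0 => /eqP.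
apply: dot_eq0; rewrite {1}/y dotDl sym// symJ//.
by rewrite dot_imx addNr.
Qed.

End LeafCurves.

(** * Normal geodesics *)

Section Geodesics.
Variables (R : realType) (n : nat).
Local Notation C := ('cV[R]_(n.+1 + n.+1)).
Local Notation J := (imx R n).
Implicit Types (A B D X : ambient R n) (z v : C).

(** The shape taken by [hopf] along a great circle, see [hopf_turn]. Arbitrary coefficients make the
    family closed under differentiation, whence smoothness by induction. *)
Definition trig_curve A B D (t : R) : ambient R n :=
  cos t ^+ 2 *: A + (cos t * sin t) *: B + sin t ^+ 2 *: D.

Lemma trig_curve_derive A B D (t w : R) : is_derive t w (trig_curve A B D)
  (w *: trig_curve B (2 *: (D - A)) (- B) t).
Proof.
suff H : is_derive t 1 (trig_curve A B D) (trig_curve B (2 *: (D - A)) (- B) t).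
  have d : differentiable (trig_curve A B D) t by apply/derivable1_diffP;
    case: H.
  split; first exact: diff_derivable.
  rewrite deriveE//; set df := 'd _ _.
  have -> : df w = w *: df 1 by rewrite -linearZ /= [w *: 1]mulr1.
  by congr (_ *: _); rewrite /df -deriveE//; case: H.
apply/is_derive_mxP => i j.
have dc := is_derive_cos t; have ds := is_derive_sin t.
have ck (k : R) : is_derive t 1 (cst k : R -> R) 0 by exact: is_derive_cst.
have := is_deriveD (is_deriveD (is_deriveM (is_deriveM dc dc) (ck (A i j)))
  (is_deriveM (is_deriveM dc ds) (ck (B i j))))
  (is_deriveM (is_deriveM ds ds) (ck (D i j))).
set f := (X in is_derive _ _ X _) => fd.
have -> : (fun s => trig_curve A B D s i j) = f.
  by apply/funext => s; rewrite /f /trig_curve !mxE !expr2.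
apply: (is_derive_eq fd); rewrite /trig_curve !mxE /GRing.scale /=; ring.
Qed.

Lemma smooth_trig_curve (I : set R) A B D : smooth I (trig_curve A B D).
Proof.
move=> k; elim: k A B D => [|k IHk] A B D.
  move=> t _; apply: derivable_continuous;
    by case: (trig_curve_derive A B D t 1).
split=> [t _|w].
  by apply/derivable1_diffP; case: (trig_curve_derive A B D t 1).
have -> : 'D_w (trig_curve A B D) =
    trig_curve (w *: B) (w *: (2 *: (D - A))) (w *: - B).
  apply/funext => t; case: (trig_curve_derive A B D t w) => _ ->.
  by rewrite /trig_curve; apply/matrixP => i j; rewrite !mxE; ring.
exact: IHk.
Qed.

Lemma derive1_trig_curve A B D t :
  'D_1 (trig_curve A B D) t = trig_curve B (2 *: (D - A)) (- B) t.
Proof. by case: (trig_curve_derive A B D t 1) => _ ->; exact: scale1r. Qed.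

Lemma hopf_turn (c s : R) z v : hopf (turn c s z v) =
  c ^+ 2 *: hopf z + (c * s) *: dhopf z v + s ^+ 2 *: hopf v.
Proof.
rewrite /hopf /dhopf /turn mulmxDr -!scalemxAr.
move: (J *m z) (J *m v) => z' v'.
have E (a b : C) : (c *: a + s *: b) *m (c *: a + s *: b)^T = c ^+ 2 *: (a *m
  a^T) +
    (c * s) *: (b *m a^T + a *m b^T) + s ^+ 2 *: (b *m b^T).
  rewrite linearD !linearZ /= mulmxDl !mulmxDr -!scalemxAl -!scalemxAr !scalerA.
  by apply/matrixP => i j; rewrite !mxE; ring.
by rewrite !E; apply/matrixP => i j; rewrite !mxE; ring.
Qed.

Lemma dhopf_turn (c s : R) z v : dhopf (turn c s z v) (turn (- s) c z v) =
  c ^+ 2 *: dhopf z v + (c * s) *: (2 *: (hopf v - hopf z)) + s ^+ 2 *: - dhopf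
    z v.
Proof.
rewrite /hopf /dhopf /turn !mulmxDr -!scalemxAr.
move: (J *m z) (J *m v) => z' v'.
have T (a b : R) (x y : C) : (a *: x + b *: y)^T = a *: x^T + b *: y^T.
  by rewrite linearD !linearZ.
rewrite !T !mulmxDl !mulmxDr -!scalemxAl -!scalemxAr !scalerA.
by apply/matrixP => i j; rewrite !mxE; ring.
Qed.

Variables (O : set (ambient R n)) (F : foliation O).
Hypotheses (OCP : O `<=` CP R n) (rF : riemannian F).


Lemma frame_geodesic z v t : frame z v -> frame (point z v t) (velocity z v t).
Proof. by apply: frame_turn; rewrite cos2Dsin2. Qed.

Lemma frame_horizontal z v : frame z v -> horizontal z v.
Proof. by case. Qed.

Lemma geodesic_hopf (I : set R) z v : frame z v ->
  (forall t, I t -> O (hopf (point z v t))) ->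
  geodesic I (fun t => hopf (point z v t)).
Proof.
move=> fzv IO; set c := (fun t => _).
have cE : c = trig_curve (hopf z) (dhopf z v) (hopf v).
  by apply/funext => t; exact: hopf_turn.
split; first by rewrite cE; exact: smooth_trig_curve.
  by move=> t It; exact/OCP/IO.
move=> t It X tX; rewrite cE.
rewrite (funext (derive1_trig_curve _ _ _)) derive1_trig_curve.
have [zz vv zv Jzv] := frame_geodesic t fzv.
(* The acceleration is a difference of projectors onto the complex lines of velocity and point. A
   tangent vector [X] has no diagonal part on either line, so both traces vanish. *)
have -> : trig_curve (2 *: (hopf v - hopf z)) (2 *: (- dhopf z v - dhopf z v))
    (- (2 *: (hopf v - hopf z))) t =
    2 *: (hopf (velocity z v t) - hopf (point z v t)).
  by rewrite !hopf_turn /trig_curve; apply/matrixP => i j; rewrite !mxE; ring.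
have hX y : \tr (hopf y *m X) = dot y (X *m y) + dot y (X *m y).
  have [_ _ XJ] := tX.
  have trX (w : C) : \tr (w *m w^T *m X) = dot w (X *m w).
    by rewrite -mulmxA mxtrace_mulC -mulmxA.
  rewrite /hopf mulmxDl raddfD /= !trX; congr (_ + _).
  by rewrite mulmxA XJ -mulmxA dotJJ.
have [[zX _] _] := tangentCP_horizontal zz tX.
rewrite /fubini_study linearZ linearB /= !hopf_tr -scalemxAl mulmxBl.
rewrite mxtraceZ raddfB /= !hX zX (tangentCP_hopf_perp tX)//.
by rewrite !addr0 subrr mulr0 mul0r.
Qed.

Lemma orthogonal_at_normal z v t : frame z v -> O (hopf (point z v t)) ->
  orthogonal_at F (fun t => hopf (point z v t)) t <->
  normal_at F (point z v t) (velocity z v t).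
Proof.
move=> fzv Ot; have ft := frame_geodesic t fzv; have [zz _ _ _] := ft.
have cE : 'D_1 (fun t => hopf (point z v t)) t = dhopf (point z v t) (velocity
  z v t).
  rewrite (_ : (fun t => _) = trig_curve (hopf z) (dhopf z v) (hopf v)).
    by rewrite derive1_trig_curve dhopf_turn.
  by apply/funext => s; exact: hopf_turn.
have horiz := frame_horizontal ft.
split=> [H a X aP aX|H a aP X aX]; have tX := leaf_tangentCP OCP aX.
  by have := H a aP X aX; rewrite cE fubini_study_tangentCP.
by rewrite cE fubini_study_tangentCP//; exact: (H a).
Qed.

(** The geodesic starts orthogonally, so in the dichotomy given by [riemannian] the case of a
    nowhere orthogonal geodesic fails at time 0. *)
Lemma normal_geodesic (r : R) z v : frame z v -> normal_at F z v ->
  (forall t, `|t| < r -> O (hopf (point z v t))) ->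
  forall t, `|t| < r -> normal_at F (point z v t) (velocity z v t).
Proof.
move=> fzv nzv rO t tr; pose I : set R := `]- r, r[%classic.
have IE s : I s <-> `|s| < r by rewrite /I /= in_itv /= ltr_norml.
have IO s : I s -> O (hopf (point z v s)) by move=> /IE; exact: rO.
have I0 : I 0 by apply/IE; rewrite normr0; exact: le_lt_trans tr.
have [||||H|H] := rF (I := I) (c := fun t => hopf (point z v t)).
- exact: interval_open.
- exact: interval_is_interval.
- exact: geodesic_hopf.
- by [].
- by apply/orthogonal_at_normal => //; [exact: rO|apply/H/IE].
- exfalso; apply: (H 0 I0); apply/orthogonal_at_normal => //; first exact: IO.
  by rewrite cos0 sin0 /turn oppr0 !scale0r !scale1r addr0 add0r.
Qed.

End Geodesics.

(** * Transport and uniqueness of normal curves *)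

Section NormalCurves.
Variables (R : realType) (n : nat) (O : set (ambient R n)) (F : foliation O).
Hypotheses (OCP : O `<=` CP R n).
Local Notation C := ('cV[R]_(n.+1 + n.+1)).
Local Notation J := (imx R n).

Lemma dhopf_polar (z v : C) : dhopf z v = hopf (z + v) - hopf z - hopf v.
Proof.
have := hopf_expand z v 1; rewrite expr1n !scale1r => ->.
by rewrite addrAC addrK addrAC subrr add0r.
Qed.

(** Joint continuity in both parameters gives a length [r] that serves all nearby frames at once. *)
Lemma hopf_turn_near (U : set (ambient R n)) (zs vs : R -> C) :
  derivable zs 0 1 -> derivable vs 0 1 -> open U -> U (hopf (zs 0)) ->
  exists2 r : R, 0 < r & \forall s \near (0 : R), forall t, `|t| < r ->
    U (hopf (point (zs s) (vs s) t)).
Proof.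
move=> zd vd oU Uz.
have hc (f : R -> C) : derivable f 0 1 -> {for (0 : R), continuous (fun s =>
  hopf (f s))}.
  by move=> /derivableP /is_derive_hopf [fd _]; exact: derivable_continuous.
pose G (p : R * R) := hopf (point (zs p.2) (vs p.2) p.1).
have Gc : {for ((0 : R), (0 : R)), continuous G}.
  have zc := hc _ zd; have vc := hc _ vd; have zvc := hc _ (derivableD zd vd).
  have c1 : {for ((0 : R), (0 : R)), continuous (fun p : R * R => cos p.1)}.
    apply: (@continuous_comp _ _ _ fst cos); first exact: cvg_fst.
    exact: continuous_cos.
  have s1 : {for ((0 : R), (0 : R)), continuous (fun p : R * R => sin p.1)}.
    apply: (@continuous_comp _ _ _ fst sin); first exact: cvg_fst.
    exact: continuous_sin.
  have snd_c (h : R -> ambient R n) : {for (0 : R), continuous h} ->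
      {for ((0 : R), (0 : R)), continuous (fun p : R * R => h p.2)}.
    by move=> ch; apply: (@continuous_comp _ _ _ snd h); first exact: cvg_snd.
  have -> : G = (fun p => (cos p.1 * cos p.1) *: hopf (zs p.2) +
      (cos p.1 * sin p.1) *: (hopf (zs p.2 + vs p.2) - hopf (zs p.2) - hopf (vs
        p.2)) +
      (sin p.1 * sin p.1) *: hopf (vs p.2)).
    by apply/funext => p; rewrite /G hopf_turn dhopf_polar -!expr2.
  have zc2 := snd_c _ zc; have vc2 := snd_c _ vc; have zvc2 := snd_c _ zvc.
  apply: continuousD; [apply: continuousD|]; apply: continuousZ.
  - exact: continuousM.
  - exact: zc2.
  - exact: continuousM.
  - exact: (continuousB (continuousB zvc2 zc2) vc2).
  - exact: continuousM.
  - exact: vc2.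
have : \forall p \near ((0 : R), (0 : R)), U (G p).
  apply: Gc; apply: open_nbhs_nbhs; split=> //.
  by rewrite /G /= cos0 sin0 /turn scale1r scale0r addr0.
move=> [[P Q] /= [/nbhs_normP[r /= r0 rP] nQ] PQ]; exists r => //.
apply: filterS nQ => s Qs t tr; apply: (PQ (t, s)); split=> //=.
by apply: rP; rewrite /= sub0r normrN.
Qed.

Lemma is_derive_turn (c s : R) (zs vs : R -> C) (t : R) (a b : C) :
  is_derive t 1 zs a -> is_derive t 1 vs b ->
  is_derive t 1 (fun x => turn c s (zs x) (vs x)) (turn c s a b).
Proof. by move=> zd vd; apply: is_deriveD; exact: is_deriveZ. Qed.

(* Normal geodesics stay normal, so that a curve of normal frames can be moved
   along them. *)
Lemma normal_curve_geodesic z v a b : open_in_CP O -> riemannian F ->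
  normal_curve F z v a b -> \forall t \near (0 : R),
  normal_curve F (point z v t) (velocity z v t)
    (turn (cos t) (sin t) a b) (turn (- sin t) (cos t) a b).
Proof.
move=> [U oU OE] rF [zs [vs [z0 v0 zd vd nzv]]].
have [r r0 rU] : exists2 r : R, 0 < r & \forall s \near (0 : R), forall t, `|t|
  < r ->
    U (hopf (point (zs s) (vs s) t)).
  apply: hopf_turn_near => //.
  by have [_ + _] := nbhs_singleton nzv; rewrite OE => -[].
apply/nbhs_normP; exists r => // t /=; rewrite sub0r normrN => tr.
exists (fun s => point (zs s) (vs s) t), (fun s => velocity (zs s) (vs s) t).
split; rewrite ?z0 ?v0 //; try exact: is_derive_turn.
apply: filterS2 nzv rU => s [fs Os ns] Us.
have Ot x : `|x| < r -> O (hopf (point (zs s) (vs s) x)).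
  move=> xr; rewrite OE; split; last exact: Us.
  by apply: hopf_CP; have [] := frame_geodesic x fs.
split; [exact: frame_geodesic|exact: Ot|].
exact: (normal_geodesic OCP rF fs ns Ot).
Qed.

Lemma normal_curve_frame z v a b : normal_curve F z v a b -> normal_frame F z v.
Proof.
by move=> [zs [vs [<- <- _ _ /nbhs_singleton]]].
Qed.

(* [b] is determined by [a] along the tangent fields of the foliation: it is a
   first derivative of the field of normal lines. *)
Lemma normal_curve_pairing z v a X : tangent_field O (leaf F) X ->
  exists c, forall b, normal_curve F z v a b -> dot b (X (hopf z) *m z) = c.
Proof.
move=> [Xs Xt]; have [Oz|Oz] := pselect (O (hopf z)); last first.
  by exists 0 => b /normal_curve_frame[].
have [U [g [oU Uz gs gX]]] := Xs _ Oz.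
have gz : g (hopf z) = X (hopf z) by apply: gX; rewrite inE.
(* This value comes from differentiating the orthogonality of [vs s] to the lift of the tangent
   field at [zs s], and it does not involve [b]. *)
exists (- dot v ('D_(dhopf z a) g (hopf z) *m z + g (hopf z) *m a)).
move=> b [zs [vs [z0 v0 zd vd nzv]]].
have hd := is_derive_hopf zd; rewrite z0 in hd.
have gD : differentiable g (hopf (zs 0)).
  by rewrite z0; exact: smooth_differentiable gs Uz.
have ghd := is_derive_compR gD hd; rewrite z0 in ghd.
have := is_derive_dot vd (is_derive_mulmx ghd zd); rewrite v0 z0 => D.
apply/eqP; rewrite -addr_eq0 -gz; apply/eqP; apply: is_derive_near_cst D.
have Uh : \forall s \near (0 : R), U (hopf (zs s)).
  have hc := derivable_continuous (@ex_derive _ _ _ _ _ _ _ hd).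
  by apply: hc; apply: open_nbhs_nbhs; rewrite z0.
apply: filterS2 Uh nzv => s Us [_ Os ns].
rewrite gX ?inE//; have [c cz] := leaf_exists F Os.
exact: ns cz (Xt _ _ cz).
Qed.

(* Tangent fields spanning the whole tangent space of the leaf at one point are
   independent nearby, which carries the maximality of the dimension along the
   normal geodesics. *)
Definition fields_span z v := forall x : C, perp z v x ->
  (forall X, tangent_field O (leaf F) X -> dot x (X (hopf z) *m z) = 0) ->
  x = 0.

(** The two velocities have the same pairing with every tangent field, so their difference is killed
    by [fields_span]. *)
Lemma normal_curve_unique z v a b b' : fields_span z v ->
  perp z v b -> perp z v b' ->
  normal_curve F z v a b -> normal_curve F z v a b' -> b = b'.
Proof.
move=> sp pb pb' cb cb'; apply/eqP; rewrite -subr_eq0; apply/eqP/sp.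
  by rewrite -[b]scale1r -scaleN1r; exact: perpD.
move=> X /(normal_curve_pairing z v a)[c cE].
by rewrite dotDl dotNl !cE// subrr.
Qed.

(** A vector of [perp z v] orthogonal to the leaf is orthogonal to all tangent fields, hence zero;
    this bounds the dimension of the leaf from below. *)
Lemma fields_span_leq z v a i u : fields_span z v ->
  chart_dom (leaf F a) i u -> chart (leaf F a) i u = hopf z ->
  (n.+1 + n.+1 <= sdim (leaf F a) + 4)%N.
Proof.
move=> sp Du uz.
pose K := \matrix_j ('D_(delta_mx 0 j) (chart (leaf F a) i) u *m z)^T.
apply: (orthogonal_trivial_leq (K := K) (E := frame_mx z v)) => x Kx
  /frame_mx_eq0 px.
have nx : normal_at F z x.
  apply: (normal_rangeP x Du uz).2 => j.
  have := congr1 (fun Q : 'cV_(sdim (leaf F a)) => Q j 0) Kx.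
  by rewrite /= mulmx_dot rowK trmxK mxE dotC.
have az : points (leaf F a) (hopf z) by exists i, u.
by apply: sp => // X [_ Xt]; apply: nx az (Xt _ _ az).
Qed.

End NormalCurves.

(** * Persistence of the maximal leaf dimension along a normal geodesic *)

Section Regular.
Variables (R : realType) (n : nat) (O : set (ambient R n)) (F : foliation O).
Hypotheses (OCP : O `<=` CP R n) (cF : complex_foliation F).
Local Notation C := ('cV[R]_(n.+1 + n.+1)).
Local Notation J := (imx R n).

Lemma point0 (z v : C) : point z v 0 = z.
Proof. by rewrite cos0 sin0 /turn scale1r scale0r addr0. Qed.

Lemma velocity0 (z v : C) : velocity z v 0 = v.
Proof. by rewrite cos0 sin0 /turn oppr0 scale1r scale0r add0r. Qed.

Lemma is_derive_point (z v : C) (t : R) :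
  is_derive t 1 (fun t => point z v t) (velocity z v t).
Proof.
have zc : is_derive t 1 (cst z : R -> C) 0 by exact: is_derive_cst.
have vc : is_derive t 1 (cst v : R -> C) 0 by exact: is_derive_cst.
apply: (is_derive_eq (is_deriveD (is_derive_scale (is_derive_cos t) zc)
  (is_derive_scale (is_derive_sin t) vc))).
by rewrite !scaler0 !addr0.
Qed.

Lemma is_derive_velocity (z v : C) (t : R) :
  is_derive t 1 (fun t => velocity z v t) (- point z v t).
Proof.
have zc : is_derive t 1 (cst z : R -> C) 0 by exact: is_derive_cst.
have vc : is_derive t 1 (cst v : R -> C) 0 by exact: is_derive_cst.
apply: (is_derive_eq (is_deriveD (is_derive_scale (is_deriveN (is_derive_sin
  t)) zc)
  (is_derive_scale (is_derive_cos t) vc))).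
by rewrite !scaler0 !addr0 /turn opprD !scaleNr.
Qed.

Lemma derivable_frame_mx (zs vs : R -> C) (t : R) :
  derivable zs t 1 -> derivable vs t 1 ->
  derivable (fun s => frame_mx (zs s) (vs s)) t 1.
Proof.
have tr (f : R -> C) : derivable f t 1 -> derivable (fun s => (f s)^T) t 1.
  by move=> /derivableP /is_derive_trmx [].
have Jd (f : R -> C) : derivable f t 1 -> derivable (fun s => J *m f s) t 1.
  by move=> /derivableP /(is_derive_mulmxl J) [].
move=> zd vd; apply: derivable_col_mx; apply: derivable_col_mx.
- exact: tr.
- exact: tr (Jd _ zd).
- exact: tr.
- exact: tr (Jd _ vd).
Qed.

Lemma fields_span_near a i u z v : chart_dom (leaf F a) i u ->
  chart (leaf F a) i u = hopf z -> frame z v -> normal_at F z v ->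
  (sdim (leaf F a) + 4)%N = (n.+1 + n.+1)%N ->
  \forall t \near (0 : R), O (hopf (point z v t)) ->
    fields_span F (point z v t) (velocity z v t).
Proof.
move=> Du uz fzv nzv dn; have [z1 _ _ _] := fzv.
have az : points (leaf F a) (hopf z) by exists i, u.
have Oz := leaf_sub az.
pose A j := 'D_(delta_mx 0 j) (chart (leaf F a) i) u.
(* The tangency axiom of a foliation extends each coordinate vector at the starting point to a
   global tangent field; [g] below collects smooth local extensions of these fields to the matrix
   space. *)
have [X XP] : {X & forall j, tangent_field O (leaf F) (X j) /\ X j (hopf z) =
  A j}.
  apply: (@boolp.choice _ _ (fun j Xj => tangent_field O (leaf F) Xj /\ Xj
    (hopf z) = A j)).
  move=> j; have : tangent (leaf F a) (hopf z) (A j).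
    by rewrite -uz; exact: chart_tangent.
  by rewrite leaf_tangent// => -[X Xt XA]; exists X.
have [g gP] : {g & forall j, exists U, [/\ open U, U (hopf z), smooth U (g j) &
    {in U `&` O, g j =1 X j}]}.
  apply: (@boolp.choice _ _ (fun j g => exists U, [/\ open U, U (hopf z),
    smooth U g &
    {in U `&` O, g =1 X j}])).
  by move=> j; have [[+ _] _] := XP j; move=> /(_ _ Oz)[U [g gU]]; exists g, U.
pose K t : 'M[R]_(sdim (leaf F a), n.+1 + n.+1) :=
  \matrix_j (g j (hopf (point z v t)) *m point z v t)^T.
pose M t := col_mx (K t) (frame_mx (point z v t) (velocity z v t)).
have gz j : g j (hopf z) = A j.
  have [U [oU Uz gs gX]] := gP j; rewrite gX ?inE//.
  by have [_ ->] := XP j.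
have Minj (x : C) : M 0 *m x = 0 -> x = 0.
  rewrite /M (mul_col_mx (K 0)) -(col_mx0 _ _ (1 + 1 + (1 + 1))).
  move=> /eq_col_mx[Kx]; rewrite point0 velocity0 => /frame_mx_eq0 px.
  apply: (leaf_span OCP cF Du uz z1 fzv nzv dn px) => w.
  rewrite derive_rV; last exact: chart_differentiable.
  rewrite dotC mulmx_suml /dot mulmx_sumr raddf_sum big1//= => j _.
  rewrite -scalemxAl -scalemxAr mxtraceZ -[\tr _]/(dot x (A j *m z)) dotC.
  have := congr1 (fun Q : 'cV_(sdim (leaf F a)) => Q j 0) Kx.
  by rewrite /= mulmx_dot rowK trmxK mxE point0 gz => ->; rewrite mulr0.
have pd : is_derive (0 : R) 1 (fun t => point z v t) v.
  by have := is_derive_point z v 0; rewrite velocity0.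
have hd := is_derive_hopf pd; rewrite point0 in hd.
have Md : derivable M 0 1.
  apply: derivable_col_mx; last first.
    by apply: derivable_frame_mx; [case: pd|case: (is_derive_velocity z v 0)].
  apply/derivable_mxP => j k; under eq_fun do rewrite 2!mxE.
  have [U [oU Uz gs gX]] := gP j.
  have gD : differentiable (g j) (hopf (point z v 0)).
    by rewrite point0; exact: smooth_differentiable gs Uz.
  have [gd _] := is_derive_mulmx (is_derive_compR gD hd) pd.
  by move: gd => /derivable_mxP/(_ k 0).
have hc := derivable_continuous (@ex_derive _ _ _ _ _ _ _ hd).
have gnear : \forall t \near (0 : R), forall j, O (hopf (point z v t)) ->
    g j (hopf (point z v t)) = X j (hopf (point z v t)).
  suff H j : \forall t \near (0 : R), O (hopf (point z v t)) ->
    g j (hopf (point z v t)) = X j (hopf (point z v t)) by exact: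
      (filter_forall _ H).
  have [U [oU Uz gs gX]] := gP j.
  have : \forall t \near (0 : R), U (hopf (point z v t)).
    by apply: hc; apply: open_nbhs_nbhs; rewrite point0.
  by apply: filterS => t Ut Ot; apply: gX; rewrite inE.
(* The fields and the frame have no common orthogonal vector at time 0, and this injectivity is an
   open condition. *)
apply: filterS2 (near_mulmx_inj Md Minj) gnear => t Mt gt Ot x px xX.
apply: Mt; rewrite /M (mul_col_mx (K t)) (frame_mx_eq0 _ _ _).2//.
suff -> : K t *m x = 0 by rewrite col_mx0.
apply/colP => j; rewrite mulmx_dot rowK trmxK mxE dotC gt//.
by apply: xX; have [] := XP j.
Qed.

End Regular.

(* n = 1 is excluded: the points of an open subset of P^1 form a complex
   Riemannian foliation of complex dimension 0, hence of codimension 1. *)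
Theorem theorem1p2 (R : realType) (n : nat) (hn : (1 < n)%N)
    (O : set (ambient R n)) (hO : open_in_CP O) :
  ~ exists F : foliation O,
      [/\ complex_foliation F, riemannian F & complex_codim n F 1].
Proof.
pose J := imx R n; move=> [F [cF rF [m [[a0 da0] dF] nm]]].
have OCP : O `<=` CP R n by case: hO => U _ -> P [].
(* With [n = m + 1], the leaf of real dimension [2 * m] and the two complex lines of a frame fill
   C^{n+1}. *)
have dn : (sdim (leaf F a0) + 4)%N = (n.+1 + n.+1)%N by rewrite da0 nm; lia.
have [P0 [i [u [Du uP]]]] := @leaf_nonempty _ _ _ F a0.
have : CP R n P0 by rewrite -uP; apply: OCP; exact: (leaf_chart_sub Du).
rewrite CPE => -[z /= z1 zP0].
have uz : chart (leaf F a0) i u = hopf z by rewrite uP zP0.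
have [|v [fzv nzv]] := leaf_normal_exists Du uz z1; first by lia.
have [S [Sp _ SJ]] := shape_operator OCP cF Du uz z1 fzv nzv dn.
(* Here [1 < n] enters: the four rows of the frame matrix leave room for a nonzero [a]. The matrix
   without rows imposes no further condition. *)
have [|a [a0' _ /frame_mx_eq0 pa]] :=
  orthogonal_nontrivial (0 : 'M[R]_(0, n.+1 + n.+1)) (frame_mx z v);
    first by lia.
have pJa := perp_imx pa.
pose b := S a; have [pb cb] := Sp _ pa; have [pJb cJb] := Sp _ pJa.
rewrite (SJ _ pa) -/b in cJb; rewrite -/b in pb cb.
pose good t := [/\ cos t != 0,
  normal_curve F (point z v t) (velocity z v t) (point a b t) (velocity a b t),
  normal_curve F (point z v t) (velocity z v t)
    (point (J *m a) (- (J *m b)) t) (velocity (J *m a) (- (J *m b)) t) &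
  O (hopf (point z v t)) -> fields_span F (point z v t) (velocity z v t)].
have [t [t0 tpi [ct T1 T2 Sp_t]]] : exists t, [/\ 0 < t, t < pi & good t].
  have : \forall t \near (0 : R), good t.
    have c0 : \forall t \near (0 : R), cos t != 0.
      by apply: (cvgr_neq0 _ (@continuous_cos R 0)); rewrite cos0 oner_neq0.
    have T1 := normal_curve_geodesic OCP hO rF cb.
    have T2 := normal_curve_geodesic OCP hO rF cJb.
    have sp := fields_span_near OCP cF Du uz fzv nzv dn.
    by apply: filterS3 c0 (filterI T1 T2) sp => t ? [? ?] ?; split.
  move=> /nbhs_normP[r /= r0 rP].
  have p0 : 0 < Num.min r pi by rewrite lt_min r0 pi_gt0.
  (* Halving keeps [t] inside the neighbourhood and below [pi], where the sine is positive. *)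
  pose t := Num.min r (pi : R) / 2.
  have t0 : 0 < t by rewrite divr_gt0.
  have tlt : t < Num.min r pi by rewrite ltr_pdivrMr// ltr_pMr// ltr1n.
  move: tlt; rewrite lt_min => /andP[tr tpi].
  by exists t; split=> //; apply: rP; rewrite /= sub0r normrN gtr0_norm.
move: T1 T2 Sp_t; set c := cos t; set s := sin t => T1 T2 Sp_t.
have s0 : 0 < s by apply: sin_gt0_pi; rewrite t0.
have cs : c ^+ 2 + s ^+ 2 = 1 by exact: cos2Dsin2.
set z' := turn c s z v in T1 T2 Sp_t; set v' := turn (- s) c z v in T1 T2 Sp_t.
have [fzv' Oz' nzv'] := normal_curve_frame T1.
have span := Sp_t Oz'.
have [a1 [i' [u' [Du' uz']]]] := leaf_exists F Oz'.
(* Maximality of the dimension gives one inequality, the spanning tangent fields the other. *)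
have dn' : (sdim (leaf F a1) + 4)%N = (n.+1 + n.+1)%N.
  have := fields_span_leq span Du' uz'; have := dF a1; lia.
have z1' : dot z' z' = 1 by case: fzv'.
have [S' [Sp' Ssym SJ']] := shape_operator OCP cF Du' uz' z1' fzv' nzv' dn'.
have perpE : perp z' v' = perp z v by exact: perp_turn.
have S'E x y : perp z v x -> perp z v y -> normal_curve F z' v' x y -> S' x = y.
  rewrite -perpE => px py cxy; have [pS cS] := Sp' _ px.
  exact: normal_curve_unique span pS py cS cxy.
have pD e f : perp z v (turn e f a b) by exact: perpD.
have S1 : S' (turn c s a b) = turn (- s) c a b by exact: S'E.
have Jturn e f : turn e f (J *m a) (- (J *m b)) = J *m turn e (- f) a b.
  by rewrite /turn mulmxDr -!scalemxAr scalerN scaleNr.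
rewrite !Jturn in T2.
(* The second transported frame has velocities [J *m turn c (- s) a b] and
   [J *m turn (- s) (- c) a b]; anticommutation of [S'] with [J] removes the factor [J]. *)
have S2 : S' (turn c (- s) a b) = turn s c a b.
  have E := S'E _ _ (perp_imx (pD c (- s))) (perp_imx (pD (- s) (- c))) T2.
  rewrite SJ' ?perpE// in E.
  have : J *m (J *m S' (turn c (- s) a b)) =
      J *m (J *m turn s c a b).
    congr (_ *m _); apply: oppr_inj; rewrite E -mulmxN; congr (_ *m _).
    by rewrite /turn !scaleNr opprD.
  by rewrite !imxK => /oppr_inj.
(* Symmetry of [S'] is tested on the two vectors where it is known. The mixed terms in [dot a b]
   cancel and twice the product below remains. *)
have := Ssym _ _ (_ : perp z' v' (turn c s a b)) (_ : perp z' v' (turn c (- s)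
  a b)).
rewrite perpE => /(_ (pD _ _) (pD _ _)); rewrite S1 S2 /turn.
rewrite !(dotDl, dotDr, dotZl, dotZr) (dotC b a) => E.
have aa : 0 < dot a a.
  by rewrite lt_def dot_ge0 andbT; apply: contra_neq a0'; exact: dot_eq0.
have bb : 0 <= dot b b by exact: dot_ge0.
have : c * s * (dot a a + dot b b) = 0 by move: E; clear; lra.
move=> /eqP; rewrite !mulf_eq0 (negbTE ct) (gt_eqF s0) /= gt_eqF//.
by rewrite ltr_wpDr.
Qed.
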